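(* Let $S$ be a contraction on a complex Hilbert space such that $\sigma(S)\cap\mathbb T\subset\{1\}$. Let $E,F$ be complex Hilbert spaces, and let $W\in A(\mathbb D;\mathcal B(E,F))$ satisfy $$m:=\|W\|_\infty>\|W(1)\|.$$ Then $\|W(S)\|<m$.
   Context: $\mathbb D$ is the open unit disc, $\mathbb T$ the unit circle. $A(\mathbb D;\mathcal B(E,F))$ is the Banach space of functions $W:\overline{\mathbb D}\to\mathcal B(E,F)$ that are continuous in operator norm on $\overline{\mathbb D}$ and holomorphic on $\mathbb D$, with norm $\|W\|_\infty=\max_{\zeta\in\mathbb T}\|W(\zeta)\|$. For a contraction $S\in\mathcal B(H)$ and an operator-valued polynomial $W(z)=\sum_jW_jz^j$, put $W(S)=\sum_jW_j\otimes S^j:E\otimes H\to F\otimes H$ (completed Hilbert tensor products). One has $\|W(S)\|\le\|W\|_\infty$, operator-valued polynomials are dense in $A(\mathbb D;\mathcal B(E,F))$, and $W(S)$ is defined for all $W\in A(\mathbb D;\mathcal B(E,F))$ by continuous extension. *)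

(* Defs.v *)
From HB Require Import structures.
From mathcomp Require Import all_boot all_order all_algebra.
From mathcomp Require Import sesquilinear complex.
From mathcomp Require Import all_classical all_reals all_analysis.

Set Implicit Arguments.
Unset Strict Implicit.
Unset Printing Implicit Defensive.

Import Order.TTheory GRing.Theory Num.Theory numFieldNormedType.Exports.

Local Open Scope classical_set_scope.
Local Open Scope complex_scope.
Local Open Scope ring_scope.

(* Norms over R[i] take values in the nonnegative reals of R[i]; [rnorm] is the
   same norm with values in R. *)
Section RealNorm.
Variables (R : realType) (V : normedModType R[i]).

Definition rnorm (x : V) : R := complex.Re `|x|.

Lemma normE (x : V) : `|x| = (rnorm x)%:C.
Proof. by rewrite /rnorm RRe_real// ger0_real. Qed.

Lemma rnorm_ge0 x : 0 <= rnorm x.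
Proof. by rewrite -ler0c -normE. Qed.

Lemma rnorm0 : rnorm 0 = 0.
Proof. by rewrite /rnorm normr0. Qed.

Lemma rnorm0_eq0 x : rnorm x = 0 -> x = 0.
Proof. by move=> x0; apply/normr0_eq0; rewrite normE x0. Qed.

Lemma ler_rnormD x y : rnorm (x + y) <= rnorm x + rnorm y.
Proof. by rewrite -lecR rmorphD/= -!normE ler_normD. Qed.

Lemma rnormZ (a : R[i]) x : rnorm (a *: x) = complex.Re `|a| * rnorm x.
Proof.
have h : (rnorm (a *: x))%:C = (complex.Re `|a| * rnorm x)%:C :> R[i].
  by rewrite rmorphM/= RRe_real ?ger0_real// -!normE normrZ.
by have /complexI := h.
Qed.

Lemma rnormN x : rnorm (- x) = rnorm x.
Proof. by rewrite /rnorm normrN. Qed.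

End RealNorm.

Section BoundedOperators.
Variable R : realType.
Implicit Types E F G : normedModType R[i].

Record bop E F := Bop {
  bop_fun :> E -> F;
  bop_linear : linear bop_fun;
  bop_continuous : continuous bop_fun }.

HB.instance Definition _ E F (A : bop E F) :=
  GRing.isLinear.Build R[i] E F *:%R (bop_fun A) (bop_linear A).

Lemma bopP E F (A B : bop E F) : A =1 B -> A = B.
Proof.
case: A B => [f fl fc] [g gl gc]/= /funext fg; case: _ / fg in gl gc *.
by congr Bop; exact: Prop_irrelevance.
Qed.

Definition opnorm E F (A : bop E F) : R :=
  sup [set rnorm (A x) | x in [set x : E | rnorm x <= 1]].

Lemma bop_bounded E F (A : bop E F) :
  exists2 M : R, 0 <= M & forall x, rnorm (A x) <= M * rnorm x.
Proof.
have /linear_bounded_continuous/linear_boundedP := @bop_continuous _ _ A.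
move=> /pinfty_ex_gt0[r r0 rA]; have rE : (complex.Re r)%:C = r.
  by rewrite RRe_real// gtr0_real.
exists (complex.Re r) => [|x]; first by rewrite -ler0c rE ltW.
by rewrite -lecR rmorphM/= rE -!normE; exact: rA.
Qed.

Lemma opnorm_has_sup E F (A : bop E F) :
  has_sup [set rnorm (A x) | x in [set x : E | rnorm x <= 1]].
Proof.
split; first by exists (rnorm (A 0)), 0 => //=; rewrite rnorm0 ler01.
have [M M0 AM] := bop_bounded A; exists M => _ [x /= x1 <-].
by rewrite (le_trans (AM x))// ler_piMr.
Qed.

Lemma opnorm_ge0 E F (A : bop E F) : 0 <= opnorm A.
Proof.
apply: (le_trans (rnorm_ge0 (A 0))).
apply: (ub_le_sup (opnorm_has_sup A).2).
by exists 0 => //=; rewrite rnorm0 ler01.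
Qed.

Lemma opnormP E F (A : bop E F) x : rnorm (A x) <= opnorm A * rnorm x.
Proof.
have [x0|x0] := eqVneq (rnorm x) 0.
  by rewrite (rnorm0_eq0 x0) linear0 !rnorm0 mulr0.
have xgt0 : 0 < rnorm x by rewrite lt_neqAle eq_sym x0 rnorm_ge0.
rewrite -ler_pdivrMr//.
pose a : R[i] := (rnorm x)^-1%:C.
have na : complex.Re `|a| = (rnorm x)^-1.
  by rewrite ger0_norm// ler0c invr_ge0 ltW.
apply: (ub_le_sup (opnorm_has_sup A).2).
exists (a *: x) => /=; first by rewrite rnormZ na mulVf.
by rewrite linearZ/= rnormZ na mulrC.
Qed.

Lemma opnorm_le E F (A : bop E F) (M : R) : 0 <= M ->
  (forall x, rnorm (A x) <= M * rnorm x) -> opnorm A <= M.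
Proof.
move=> M0 AM; apply: ge_sup; first exact: (opnorm_has_sup A).1.
by move=> _ [x /= x1 <-]; rewrite (le_trans (AM x))// ler_piMr.
Qed.

Section Zmodule.
Variables E F : normedModType R[i].
Implicit Types (A B : bop E F) (a : R[i]).

Lemma bop0_subproof :
  linear (fun _ : E => 0 : F) /\ continuous (fun _ : E => 0 : F).
Proof.
by split=> [a x y|x]; [rewrite scaler0 addr0|exact: cvg_cst].
Qed.

Definition bop0 : bop E F := Bop bop0_subproof.1 bop0_subproof.2.

Lemma bop_opp_subproof A :
  linear (fun x => - A x) /\ continuous (fun x => - A x).
Proof.
split=> [a x y|x]; first by rewrite linearP opprD scalerN.
by apply: cvgN; exact: bop_continuous.
Qed.

Definition bop_opp A : bop E F :=
  Bop (bop_opp_subproof A).1 (bop_opp_subproof A).2.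

Lemma bop_add_subproof A B :
  linear (fun x => A x + B x) /\ continuous (fun x => A x + B x).
Proof.
split=> [a x y|x]; first by rewrite !linearP scalerDr addrACA.
by apply: cvgD; exact: bop_continuous.
Qed.

Definition bop_add A B : bop E F :=
  Bop (bop_add_subproof A B).1 (bop_add_subproof A B).2.

Lemma bop_scale_subproof a A :
  linear (fun x => a *: A x) /\ continuous (fun x => a *: A x).
Proof.
split=> [b x y|x]; first by rewrite linearP scalerDr !scalerA mulrC.
by apply: cvgZr; exact: bop_continuous.
Qed.

Definition bop_scale a A : bop E F :=
  Bop (bop_scale_subproof a A).1 (bop_scale_subproof a A).2.

HB.instance Definition _ := gen_eqMixin (bop E F).
HB.instance Definition _ := gen_choiceMixin (bop E F).

Let addA : associative bop_add.
Proof. by move=> A B D; apply: bopP => x /=; rewrite addrA. Qed.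
Let addC : commutative bop_add.
Proof. by move=> A B; apply: bopP => x /=; rewrite addrC. Qed.
Let add0 : left_id bop0 bop_add.
Proof. by move=> A; apply: bopP => x /=; rewrite add0r. Qed.
Let addN : left_inverse bop0 bop_opp bop_add.
Proof. by move=> A; apply: bopP => x /=; rewrite addNr. Qed.

HB.instance Definition _ := GRing.isZmodule.Build (bop E F) addA addC add0 addN.

Let scaleA a b A : bop_scale a (bop_scale b A) = bop_scale (a * b) A.
Proof. by apply: bopP => x /=; rewrite scalerA. Qed.
Let scale1 : left_id 1 bop_scale.
Proof. by move=> A; apply: bopP => x /=; rewrite scale1r. Qed.
Let scaleDr : right_distributive bop_scale +%R.
Proof. by move=> a A B; apply: bopP => x /=; rewrite scalerDr. Qed.
Let scaleDl A : {morph bop_scale^~ A : a b / a + b}.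
Proof. by move=> a b; apply: bopP => x /=; rewrite scalerDl. Qed.

HB.instance Definition _ := GRing.Zmodule_isLmodule.Build R[i] (bop E F)
  scaleA scale1 scaleDr scaleDl.

Let normD A B : (opnorm (A + B))%:C <= (opnorm A)%:C + (opnorm B)%:C :> R[i].
Proof.
rewrite -rmorphD/= lecR; apply: opnorm_le => [|x].
  by rewrite addr_ge0// opnorm_ge0.
by rewrite (le_trans (ler_rnormD _ _))// mulrDl lerD// opnormP.
Qed.

Let normZ_le a A : opnorm (a *: A) <= complex.Re `|a| * opnorm A.
Proof.
have a0 : 0 <= complex.Re `|a| by have := rnorm_ge0 (a : R[i]^o).
apply: opnorm_le => [|x]; first by rewrite mulr_ge0// opnorm_ge0.
by rewrite /= rnormZ -mulrA ler_wpM2l// opnormP.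
Qed.

Let normZ a A : (opnorm (a *: A))%:C = `|a| * (opnorm A)%:C :> R[i].
Proof.
have aE : `|a| = (complex.Re `|a|)%:C by rewrite RRe_real// ger0_real.
rewrite aE -rmorphM; congr (_%:C); apply/eqP; rewrite eq_le normZ_le.
have [->|a0] := eqVneq a 0; first by rewrite normr0 mul0r opnorm_ge0.
have ra0 : 0 < complex.Re `|a| by rewrite -ltcR -aE normr_gt0.
rewrite mulrC -ler_pdivlMr// mulrC.
have {1}-> : A = a^-1 *: (a *: A) by rewrite scalerA mulVf// scale1r.
rewrite (le_trans (normZ_le _ _))// ler_wpM2r ?opnorm_ge0//.
by rewrite normfV aE -fmorphV.
Qed.

Let norm0_eq0 A : (opnorm A)%:C = 0 :> R[i] -> A = 0.
Proof.
move=> /complexI A0; apply: bopP => x /=; apply: rnorm0_eq0.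
apply/eqP; rewrite eq_le rnorm_ge0 andbT.
by rewrite (le_trans (opnormP _ _))// A0 mul0r.
Qed.

HB.instance Definition _ := @Lmodule_isNormed.Build R[i] (bop E F)
  (fun A => (opnorm A)%:C) normD normZ norm0_eq0.

End Zmodule.

Lemma bop_normE E F (A : bop E F) : `|A| = (opnorm A)%:C.
Proof. by []. Qed.

Lemma bop_id_subproof E :
  linear (fun x : E => x) /\ continuous (fun x : E => x).
Proof. by split=> [a x y|x]//; exact: cvg_id. Qed.

Definition bop_id E : bop E E :=
  Bop (bop_id_subproof E).1 (bop_id_subproof E).2.

Lemma bop_comp_subproof E F G (B : bop F G) (A : bop E F) :
  linear (fun x => B (A x)) /\ continuous (fun x => B (A x)).
Proof.
split=> [a x y|x]; first by rewrite !linearP.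
by apply: continuous_comp; exact: bop_continuous.
Qed.

Definition bop_comp E F G (B : bop F G) (A : bop E F) : bop E G :=
  Bop (bop_comp_subproof B A).1 (bop_comp_subproof B A).2.

Definition bop_exp E (S : bop E E) (n : nat) : bop E E :=
  iter n (bop_comp S) (bop_id E).

Definition bop_invertible E (A : bop E E) : Prop :=
  exists2 B : bop E E, bop_comp A B = bop_id E & bop_comp B A = bop_id E.

Definition spectrum E (S : bop E E) : set R[i] :=
  [set l | ~ bop_invertible (l *: bop_id E - S)].

End BoundedOperators.

(* The inner product is linear in its first argument. *)
Record hilbertType (R : realType) := Hilbert {
  hilbert_sort :> completeNormedModType R[i];
  hdot : {dot hilbert_sort for @Num.conj R[i]};
  hdot_norm : forall x : hilbert_sort, hdot x x = `|x| ^+ 2 }.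

Section InnerProduct.
Variables (R : realType) (H : hilbertType R).
Implicit Types x y z : H.

Lemma hdotDl x y z : hdot H (x + y) z = hdot H x z + hdot H y z.
Proof. exact: linearDl. Qed.

Lemma hdotZl (a : R[i]) x z : hdot H (a *: x) z = a * hdot H x z.
Proof. exact: linearZl_LR. Qed.

Lemma hdotBl x y z : hdot H (x - y) z = hdot H x z - hdot H y z.
Proof. by rewrite hdotDl -scaleN1r hdotZl mulN1r. Qed.

Lemma hdot0l z : hdot H 0 z = 0.
Proof. by rewrite -(scale0r 0) hdotZl mul0r. Qed.

Lemma hdot_sym x y : hdot H x y = Num.conj (hdot H y x).
Proof. by rewrite hermC expr0 mul1r. Qed.

Lemma hdot_suml (I : Type) (s : seq I) (f : I -> H) z :
  hdot H (\sum_(i <- s) f i) z = \sum_(i <- s) hdot H (f i) z.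
Proof.
by elim: s => [|i s ih]; rewrite ?big_nil ?hdot0l// !big_cons hdotDl ih.
Qed.

Lemma hdot_sumr (I : Type) (s : seq I) (f : I -> H) z :
  hdot H z (\sum_(i <- s) f i) = \sum_(i <- s) hdot H z (f i).
Proof.
by rewrite hdot_sym hdot_suml rmorph_sum; apply: eq_bigr => i _; rewrite [RHS]hdot_sym.
Qed.

Lemma hdot_eq0 x : hdot H x x = 0 -> x = 0.
Proof. by rewrite hdot_norm => /eqP; rewrite expf_eq0/= normr_eq0 => /eqP. Qed.

End InnerProduct.

(* The completed Hilbert tensor product, determined up to a unique unitary: a
   Hilbert space in which the algebraic tensor product of E and H, with the
   inner product <e (x) h, e' (x) h'> = <e, e'> <h, h'>, is dense. *)
Record hilbertTensor (R : realType) (E H : hilbertType R) := HilbertTensor {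
  tensor_space :> hilbertType R;
  tensor : {bilinear E -> H -> tensor_space};
  tensor_dot : forall e e' h h',
    hdot tensor_space (tensor e h) (tensor e' h') = hdot E e e' * hdot H h h';
  tensor_dense : dense
    [set \sum_(p <- s) tensor p.1 p.2 | s in [set: seq (E * H)]] }.

Section TensorOperator.
Variable R : realType.
Implicit Types E F G H K : hilbertType R.

(* A (x) B is the unique bounded operator with this action on elementary
   tensors; see tensor_bopE below for its existence. *)
Definition tensor_bop E F H K (EH : hilbertTensor E H) (FK : hilbertTensor F K)
    (A : bop E F) (B : bop H K) : bop EH FK :=
  xget 0 [set T : bop EH FK |
    forall e h, T (tensor EH e h) = tensor FK (A e) (B h)].

Definition gram E H (s : seq (E * H)) : R[i] :=
  \sum_(p <- s) \sum_(q <- s) hdot E p.1 q.1 * hdot H p.2 q.2.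

Lemma gram_tensor E H (EH : hilbertTensor E H) (s : seq (E * H)) :
  gram s = `|\sum_(p <- s) tensor EH p.1 p.2| ^+ 2.
Proof.
rewrite -hdot_norm hdot_suml; apply: eq_bigr => p _.
by rewrite hdot_sumr; apply: eq_bigr => q _; rewrite tensor_dot.
Qed.

Definition orth E H (p q : E * H) := hdot H p.2 q.2 == 0.

Definition coef E H (h : H) (p : E * H) : R[i] := hdot H h p.2 / hdot H p.2 p.2.

Lemma orth_proj E H (h : H) (s : seq (E * H)) : pairwise (@orth E H) s ->
  all (fun p => hdot H (h - \sum_(q <- s) coef h q *: q.2) p.2 == 0) s.
Proof.
elim: s => [//|r s ih] /= /andP[/allP rs os]; apply/andP; split.
  rewrite big_cons opprD addrA !hdotBl hdotZl hdot_suml big_seq big1 => [|q /rs rq]; last first.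
    rewrite hdotZl hdot_sym; move: rq; rewrite /orth => /eqP ->.
    by rewrite rmorph0 mulr0.
  rewrite subr0 subr_eq0 eq_sym; apply/eqP.
  have [r0|r0] := eqVneq (hdot H r.2 r.2) 0; last by rewrite /coef divfK.
  rewrite /coef r0 mulr0 (hdot_eq0 r0) hdot_sym hdot0l.
  by rewrite rmorph0.
apply/allP => p ps; have /allP/(_ p ps)/eqP := ih os.
rewrite big_cons opprD addrCA addrC => hp; rewrite hdotBl hp sub0r hdotZl.
by move: (rs p ps); rewrite /orth => /eqP ->; rewrite mulr0 oppr0.
Qed.

Lemma orthogonalize E H (s : seq (E * H)) : exists2 s' : seq (E * H),
  pairwise (@orth E H) s' &
  forall b : E -> H -> R[i]^o, (forall h, linear (b^~ h)) ->
    (forall e, linear (b e)) ->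
    \sum_(p <- s) b p.1 p.2 = \sum_(p <- s') b p.1 p.2.
Proof.
elim: s => [|[e h] s [s0 os0 s0E]]; first by exists [::].
have /allP h0 := orth_proj h os0.
exists ((e, h - \sum_(q <- s0) coef h q *: q.2) ::
        [seq (p.1 + coef h p *: e, p.2) | p <- s0]).
  rewrite /= pairwise_map os0 andbT all_map; apply/allP => p ps0.
  by apply: contraT => /=; rewrite /orth /= (h0 p ps0).
move=> b bl br; rewrite !big_cons/= big_map/= s0E//.
have bD x y z : b x (y + z) = b x y + b x z.
  by have := br x 1 y z; rewrite !scale1r.
have bZ x a y : b x (a *: y) = a *: b x y.
  have b0 : b x 0 = 0 by have := br x (-1) 0 0; rewrite scaler0 addr0 scaleN1r addNr.
  by have := br x a y 0; rewrite b0 !addr0.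
have bZl (a : R[i]) x y z : b (x + a *: y) z = b x z + a *: b y z.
  by rewrite addrC bl addrC.
rewrite [in RHS](eq_bigr (fun p => b p.1 p.2 + b e (coef h p *: p.2))); last first.
  by move=> p _; rewrite bZl bZ.
rewrite big_split/= addrCA addrC; congr (_ + _).
have -> : \sum_(p <- s0) b e (coef h p *: p.2) =
          b e (\sum_(p <- s0) coef h p *: p.2).
  elim: (s0) => [|q s1 ih]; last by rewrite !big_cons bD ih.
  by rewrite !big_nil -(scale0r (0 : H)) bZ scale0r.
by rewrite -bD subrK.
Qed.

Lemma gram_ortho E F H (A : E -> F) (s : seq (E * H)) :
  pairwise (@orth E H) s ->
  gram [seq (A p.1, p.2) | p <- s] =
    \sum_(p <- s) `|A p.1| ^+ 2 * `|p.2| ^+ 2.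
Proof.
rewrite /gram big_map; under eq_bigr do rewrite big_map/=.
elim: s => [|r s ih] /=; first by rewrite !big_nil.
move=> /andP[/allP rs os]; rewrite !big_cons -!hdot_norm -addrA; congr (_ + _).
rewrite big_seq big1 => [|q /rs]; last first.
  by rewrite /orth => /eqP ->; rewrite mulr0.
rewrite add0r -ih// big_seq [RHS]big_seq; apply: eq_bigr => q qs.
rewrite big_cons [X in X + _](_ : _ = 0) ?add0r//.
rewrite [X in _ * X]hdot_sym; move: (rs q qs); rewrite /orth => /eqP ->.
by rewrite rmorph0 mulr0.
Qed.

Lemma eq_gram E F H (A : bop E F) (s s' : seq (E * H)) :
  (forall b : E -> H -> R[i]^o, (forall h, linear (b^~ h)) ->
    (forall e, linear (b e)) ->
    \sum_(p <- s) b p.1 p.2 = \sum_(p <- s') b p.1 p.2) ->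
  gram [seq (A p.1, p.2) | p <- s] = gram [seq (A p.1, p.2) | p <- s'].
Proof.
move=> ss'; pose k (p q : E * H) := hdot F (A p.1) (A q.1) * hdot H p.2 q.2.
have kC p q : k p q = Num.conj (k q p).
  by rewrite /k rmorphM/= -!hdot_sym.
have ks q : \sum_(p <- s) k p q = \sum_(p <- s') k p q.
  apply: (ss' (fun e h => hdot F (A e) (A q.1) * hdot H h q.2)).
    by move=> h a x y; rewrite linearP hdotDl hdotZl mulrDl -mulrA.
  by move=> e a x y; rewrite hdotDl hdotZl mulrDr mulrCA.
have gE t : gram [seq (A p.1, p.2) | p <- t] = \sum_(p <- t) \sum_(q <- t) k p q.
  by rewrite /gram big_map; apply: eq_bigr => p _; rewrite big_map.
rewrite !gE exchange_big/=; under eq_bigr do rewrite ks.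
rewrite exchange_big/=; apply: eq_bigr => p _.
under eq_bigr do rewrite kC; rewrite -rmorph_sum ks rmorph_sum.
by apply: eq_bigr => q _; rewrite [RHS]kC.
Qed.

Lemma gram_bop E F H (A : bop E F) (s : seq (E * H)) :
  gram [seq (A p.1, p.2) | p <- s] <= (opnorm A)%:C ^+ 2 * gram s.
Proof.
have [s' os' ss'] := orthogonalize s.
rewrite (eq_gram A ss') gram_ortho//.
have sE (t : seq (E * H)) : t = [seq (bop_id E p.1, p.2) | p <- t].
  by rewrite (eq_map (g := id)) ?map_id// => -[].
rewrite [in leRHS](sE s) (eq_gram _ ss') gram_ortho// mulr_sumr.
apply: ler_sum => p _; rewrite [leRHS]mulrA ler_wpM2r ?exprn_ge0//.
rewrite -exprMn lerXn2r ?nnegrE ?mulr_ge0// ?ler0c ?opnorm_ge0//.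
by rewrite !normE -rmorphM/= lecR opnormP.
Qed.

Lemma gram_swap E H (s : seq (E * H)) : gram [seq (p.2, p.1) | p <- s] = gram s.
Proof.
rewrite /gram big_map; apply: eq_bigr => p _.
by rewrite big_map; apply: eq_bigr => q _; rewrite mulrC.
Qed.

Lemma gram_bop2 E F H K (A : bop E F) (B : bop H K) (s : seq (E * H)) :
  gram [seq (A p.1, B p.2) | p <- s] <=
    ((opnorm A)%:C * (opnorm B)%:C) ^+ 2 * gram s.
Proof.
have -> : [seq (A p.1, B p.2) | p <- s] =
    [seq (A p.1, p.2) | p <- [seq (p.2, p.1) |
      p <- [seq (B p.1, p.2) | p <- [seq (p.2, p.1) | p <- s]]]].
  by rewrite -!map_comp.
rewrite (le_trans (gram_bop _ _))// exprMn -[leRHS]mulrA ler_wpM2l//.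
  by rewrite exprn_ge0// ler0c opnorm_ge0.
by rewrite gram_swap (le_trans (gram_bop _ _))// gram_swap.
Qed.

Lemma tensor_norm_le E F H K (EH : hilbertTensor E H) (FK : hilbertTensor F K)
    (A : bop E F) (B : bop H K) (s : seq (E * H)) :
  `|\sum_(p <- s) tensor FK (A p.1) (B p.2)| <=
    (opnorm A)%:C * (opnorm B)%:C * `|\sum_(p <- s) tensor EH p.1 p.2|.
Proof.
rewrite -(@ler_pXn2r _ 2)// ?nnegrE ?mulr_ge0 ?ler0c ?opnorm_ge0//.
rewrite exprMn -gram_tensor (le_trans _ (gram_bop2 _ _ _))//.
by rewrite (gram_tensor FK) big_map.
Qed.

Lemma bop_extension (U : normedModType R[i]) (V : completeNormedModType R[i])
    (G : U -> V -> Prop) (M : R[i]) : 0 <= M ->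
  (forall a u u' v v', G u v -> G u' v' -> G (a *: u + u') (a *: v + v')) ->
  (forall u v, G u v -> `|v| <= M * `|u|) ->
  dense [set u | exists v, G u v] ->
  exists T : bop U V, forall u v, G u v -> T u = v.
Proof.
move=> M0 Glin GM Gdense.
pose cl u v := forall e : R[i], 0 < e ->
  exists u' v', [/\ G u' v', `|u - u'| < e & `|v - v'| < e].
have subcl u v : G u v -> cl u v.
  by move=> Guv e e0; exists u, v; rewrite !subrr !normr0.
have clM u v : cl u v -> `|v| <= M * `|u|.
  move=> cuv; apply/ler_addgt0Pr => e e0.
  have M1 : 0 < M + 1 by rewrite ltr_wpDl.
  have [|u' [v' [Guv uu' vv']]] := cuv (e / (M + 1)); first by rewrite divr_gt0.
  rewrite -(subrK v' v) (le_trans (ler_normD _ _))//.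
  rewrite (le_trans (lerD (ltW vv') (GM _ _ Guv)))//.
  have : `|u'| <= `|u| + e / (M + 1).
    by rewrite -(subrK u u') (le_trans (ler_normD _ _))// addrC lerD2l distrC ltW.
  move=> /(ler_wpM2l M0)/(lerD (lexx (e / (M + 1))))/le_trans; apply.
  rewrite mulrDr addrCA lerD2l -{1}(mul1r (e / _)) -mulrDl addrC.
  by rewrite mulrC divfK ?gt_eqF.
have cllin a u u' v v' : cl u v -> cl u' v' -> cl (a *: u + u') (a *: v + v').
  move=> cuv cuv' e e0.
  have a1 : 0 < `|a| + 1 by rewrite ltr_wpDl.
  have d0 : 0 < e / (`|a| + 1) by rewrite divr_gt0.
  have [x [y [Gxy ux vy]]] := cuv _ d0.
  have [x' [y' [Gxy' ux' vy']]] := cuv' _ d0.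
  have key (W : normedModType R[i]) (w w' z z' : W) :
      `|w - z| < e / (`|a| + 1) -> `|w' - z'| < e / (`|a| + 1) ->
      `|a *: w + w' - (a *: z + z')| < e.
    move=> wz wz'; rewrite opprD addrACA -scalerBr.
    rewrite (le_lt_trans (ler_normD _ _))// normrZ.
    have -> : e = `|a| * (e / (`|a| + 1)) + e / (`|a| + 1).
      by rewrite -[X in _ + X]mul1r -mulrDl mulrC divfK ?gt_eqF.
    by rewrite ler_ltD// ler_wpM2l// ltW.
  by exists (a *: x + x'), (a *: y + y'); split; [exact: Glin|exact: key|exact: key].
have clfun u v v' : cl u v -> cl u v' -> v = v'.
  move=> cuv cuv'; have := clM _ _ (cllin (-1) _ _ _ _ cuv cuv').
  rewrite !scaleN1r addNr normr0 mulr0 normr_le0 addrC subr_eq0.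
  by move=> /eqP.
have clex u : exists v, cl u v.
  pose F := filter_from [set e : R | 0 < e]
    (fun e => [set v | exists2 u', G u' v & `|u - u'| < e%:C]).
  have Fne (e : R) : 0 < e -> exists u' v', G u' v' /\ `|u - u'| < e%:C.
    rewrite -ltcR => e0; have [|u' [/=]] := Gdense (ball u e%:C) _ (ball_open u _).
      by exists u; exact: ballxx.
    by rewrite -ball_normE/= => ue [v' Gv']; exists u', v'.
  have FF : ProperFilter F.
    apply: filter_from_proper; last first.
      by move=> e /= /Fne[u' [v' [Gv ue]]]; exists v', u'.
    apply: filter_from_filter; first by exists 1 => /=.
    move=> e d /= e0 d0; exists (Num.min e d); first by rewrite lt_min e0.
    by move=> v [u' Gv uu']; split; exists u' => //; rewrite (lt_le_trans uu')//
      lecR ge_min lexx ?orbT.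
  have Fball (e : R[i]) : 0 < e -> exists2 d : R, 0 < d &
      forall u1 v1 u2 v2, G u1 v1 -> G u2 v2 ->
      `|u - u1| < d%:C -> `|u - u2| < d%:C -> `|v1 - v2| < e.
    move=> e0; have eE : e = (complex.Re e)%:C by rewrite RRe_real// gtr0_real.
    have M1 : 0 < M + 1 by rewrite ltr_wpDl.
    have dE : (e / (M + 1) / 2) = (complex.Re (e / (M + 1) / 2))%:C.
      by rewrite RRe_real// gtr0_real// !divr_gt0.
    exists (complex.Re (e / (M + 1) / 2)); first by rewrite -ltcR -dE !divr_gt0.
    rewrite -dE => u1 v1 u2 v2 G1 G2 uu1 uu2.
    have := GM _ _ (Glin (-1) _ _ _ _ G2 G1); rewrite !scaleN1r addrC => h.
    rewrite (le_lt_trans h)//.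
    have uu : `|- u2 + u1| <= e / (M + 1).
      have -> : - u2 + u1 = (u - u2) - (u - u1).
        by rewrite [RHS]addrC opprB subrKA addrC.
      rewrite (le_trans (ler_normB _ _))//.
      by rewrite [leRHS]splitr lerD// ltW.
    rewrite (le_lt_trans (ler_wpM2l M0 uu))// mulrCA gtr_pMr//.
    by rewrite ltr_pdivrMr// mul1r ltrDl.
  have Fc : cauchy F.
    apply/cauchy_exP => e /Fball[d d0 dP].
    have [u1 [v1 [G1 uu1]]] := Fne d d0.
    exists v1; exists d => //= v2 [u2 G2 uu2]; rewrite -ball_normE/=.
    exact: (dP u1 v1 u2 v2).
  have /cvg_ex[v Fv] := @cauchy_cvg _ F FF Fc.
  exists v => e e0.
  have eE : e = (complex.Re e)%:C by rewrite RRe_real// gtr0_real.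
  have Fe : F [set v | exists2 u', G u' v & `|u - u'| < e].
    by exists (complex.Re e); [rewrite /= -ltcR -eE|rewrite -eE].
  have [v' [[u' Gv uu'] /= vv']] := filter_ex (filterI Fe (Fv _ (nbhsx_ballx v e e0))).
  by exists u', v'; split => //; move: vv'; rewrite -ball_normE.
have [T Tcl] := choice clex.
have Tlin : linear T.
  by move=> a x y; apply: (clfun _ _ _ (Tcl _)); exact: cllin.
pose Tl : {linear U -> V} := HB.pack T (GRing.isLinear.Build R[i] U V *:%R T Tlin).
have Tcont : continuous T.
  apply: (@bounded_linear_continuous _ _ _ Tl); apply/linear_boundedP.
  near=> r => x /=; rewrite (le_trans (clM _ _ (Tcl x)))// ler_wpM2r//.
  by near: r; apply: nbhs_pinfty_ge; exact: ger0_real.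
by exists (Bop Tlin Tcont) => u v Guv /=; apply: (clfun u) => //; exact: subcl.
Unshelve. all: by end_near. Qed.

Lemma tensor_bopE E F H K (EH : hilbertTensor E H) (FK : hilbertTensor F K)
    (A : bop E F) (B : bop H K) e h :
  tensor_bop EH FK A B (tensor EH e h) = tensor FK (A e) (B h).
Proof.
pose G (u : EH) (v : FK) := exists2 s : seq (E * H),
  u = \sum_(p <- s) tensor EH p.1 p.2 &
  v = \sum_(p <- s) tensor FK (A p.1) (B p.2).
have [|||u|T TG] := @bop_extension EH FK G ((opnorm A)%:C * (opnorm B)%:C).
- by rewrite mulr_ge0 ?ler0c ?opnorm_ge0.
- move=> a u u' v v' [s -> ->] [s' -> ->].
  exists ([seq (a *: p.1, p.2) | p <- s] ++ s'); rewrite big_cat big_map/=;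
    congr (_ + _); rewrite scaler_sumr; apply: eq_bigr => p _.
    by rewrite linearZl_LR.
  by rewrite linearZ linearZl_LR.
- by move=> u v [s -> ->]; exact: tensor_norm_le.
- move=> O Ou; have [w [/= Ow [s _ sw]]] := @tensor_dense _ _ _ EH u O Ou.
  exists w; split => //=; exists (\sum_(p <- s) tensor FK (A p.1) (B p.2)).
  by exists s.
rewrite /tensor_bop; case: xgetP => [T' _ /= ->//|/(_ T)[]].
move=> e' h' /=; apply: TG; exists [:: (e', h')]; by rewrite big_seq1.
Qed.

End TensorOperator.

Section DiscAlgebra.
Variables (R : realType) (E F : hilbertType R).

(* R[i]^o is R[i] as a normed module over itself. *)
Definition unit_circle : set R[i]^o := [set z | `|z| = 1].
Definition unit_disc : set R[i]^o := [set z | `|z| < 1].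
Definition closed_unit_disc : set R[i]^o := [set z | `|z| <= 1].

(* W z is meaningful for z in the closed disc only. *)
Definition disc_algebra (W : R[i]^o -> bop E F) : Prop :=
  {within closed_unit_disc, continuous W} /\
  forall z, unit_disc z -> derivable W z 1.

(* For W in the disc algebra the supremum is a maximum. *)
Definition disc_norm (W : R[i]^o -> bop E F) : R :=
  sup [set opnorm (W z) | z in unit_circle].

(* The operator-valued polynomial with coefficient sequence P is
   \sum_j P`_j z ^ j. *)
Definition op_poly (P : seq (bop E F)) : R[i]^o -> bop E F :=
  fun z => \sum_(j < size P) z ^+ j *: P`_j.

Variables (H : hilbertType R) (EH : hilbertTensor E H) (FH : hilbertTensor F H).

Definition op_poly_calc (S : bop H H) (P : seq (bop E F)) : bop EH FH :=
  \sum_(j < size P) tensor_bop EH FH P`_j (bop_exp S j).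

(* T is the value W(S) of the extension by continuity, from operator-valued
   polynomials to the disc algebra, of P |-> P(S). *)
Definition is_disc_calc (S : bop H H) (W : R[i]^o -> bop E F)
    (T : bop EH FH) : Prop :=
  exists P : nat -> seq (bop E F),
    (disc_norm (fun z => op_poly (P n) z - W z) @[n --> \oo] --> (0 : R)) /\
    (op_poly_calc S (P n) @[n --> \oo] --> T).

End DiscAlgebra.

Arguments unit_circle R : clear implicits.

(* Main.v *)
Require Import Defs.
From HB Require Import structures.
From mathcomp Require Import all_boot all_order all_algebra.
From mathcomp Require Import sesquilinear complex.
From mathcomp Require Import all_classical all_reals all_analysis.
From mathcomp Require Import cyclic separable cyclotomic zify ring lra.

Set Implicit Arguments.
Unset Strict Implicit.
Unset Printing Implicit Defensive.

Import Order.TTheory GRing.Theory Num.Theory numFieldNormedType.Exports.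
Import ComplexField.Normc.

Local Open Scope classical_set_scope.
Local Open Scope complex_scope.
Local Open Scope ring_scope.

(* Let T = r S with r < 1.  Expanding |P(T) x|^2 along the sequence T^j x
   (discretely, over the n-th roots of unity zeta_k) gives
     |P(T) x|^2 <= \sum_k w_k |P(zeta_k)|^2 + o(1)   as n tends to infinity,
   with weights w_k >= 0 of sum at most |x|^2 which do not depend on P.  Hence
   |P(S) x|^2 + |Q(S) x|^2 <= max_zeta (|P(zeta)|^2 + |Q(zeta)|^2) |x|^2, a
   von Neumann inequality for pairs.

   Since S has no spectrum on the circle outside 1, a disc B(c, r) with c > 0
   small contains the spectrum of S but misses the arc on which |W| may come
   close to its maximum.  If a and b are inverse points with respect to its
   boundary and 1 < a < b, then (b - z) / (a - z) is larger on the spectrum than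
   on the arc; a high power of it, approximated by polynomials, is a scalar
   polynomial p that is small on the arc while p(S) is bounded below.  The
   inequality for the pair (P, t p), with P close to W and t small, then gives
   |W(S) x|^2 + t^2 |x|^2 <= (m^2 + t^2 / 2) |x|^2. *)

(** * Moduli of complex numbers, roots of unity and compactness of the closed disc *)

Section Complex.
Variable R : realType.
Implicit Types z w : R[i].

Lemma normr_normc z : `|z| = (normc z)%:C.
Proof. by []. Qed.

Lemma rnorm_normc z : rnorm (z : R[i]^o) = normc z.
Proof. by []. Qed.

(** ['X^n - 1] splits over [R[i]] and is separable in characteristic 0, and n distinct n-th roots of
    unity include a primitive one. *)
Lemma prim_root_exists n : (0 < n)%N -> exists z : R[i], n.-primitive_root z.
Proof.
move=> n_gt0; pose p : {poly R[i]} := 'X^n - 1.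
have [r Dp] := closed_field_poly_normal p; move: Dp.
rewrite (monicP _) ?monicXnsubC // scale1r => Dp.
have rn1 : all n.-unity_root r by apply/allP => z; rewrite -root_prod_XsubC -Dp.
have sz_r : (n < (size r).+1)%N by rewrite -(size_prod_XsubC r id) -Dp size_XnsubC.
have [|z] := hasP (has_prim_root n_gt0 rn1 _ sz_r); last by exists z.
by rewrite -separable_prod_XsubC -Dp separable_Xn_sub_1 // pnatr_eq0 -lt0n.
Qed.

Lemma normc_ge0 z : 0 <= normc z.
Proof. exact: (@rnorm_ge0 _ R[i]^o). Qed.

Lemma normcR (s : R) : normc s%:C = `|s|.
Proof. by rewrite /= expr0n/= addr0 sqrtr_sqr. Qed.

Lemma normc_Re_le z : `|complex.Re z| <= normc z.
Proof. by rewrite -lecR; exact: normc_ge_Re. Qed.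

Lemma normc_Im_le z : `|complex.Im z| <= normc z.
Proof.
by case: z => s t /=; rewrite -sqrtr_sqr ler_wsqrtr// ?lerDr ?sqr_ge0.
Qed.

Lemma normc_le_ReIm z : normc z <= `|complex.Re z| + `|complex.Im z|.
Proof.
case: z => s t /=; rewrite -[leRHS]ger0_norm ?addr_ge0// -sqrtr_sqr ler_wsqrtr//.
by rewrite sqrrD !real_normK ?num_real// addrAC lerDl mulrn_wge0// mulr_ge0.
Qed.

(** Compactness of the closed disc, in the form that yields the uniform bounds below: local
    parameters merge into a single one because [P] only weakens as its parameter decreases. *)
Lemma closed_disc_uniform (P : R -> R[i] -> Prop) :
  (forall e d z, d <= e -> P e z -> P d z) ->
  (forall z, normc z <= 1 -> exists2 e : R, 0 < e &
     forall w, normc w <= 1 -> normc (w - z) < e -> P e w) ->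
  exists2 e : R, 0 < e & forall z, normc z <= 1 -> P e z.
Proof.
move=> Pmon Ploc.
(* Outside the closed disc, the ball of radius [normc z - 1] about [z] misses the disc and the local
   property is vacuous. *)
have {}Ploc z : exists2 e : R, 0 < e &
    forall w, normc w <= 1 -> normc (w - z) < e -> P e w.
  have [/Ploc//|z1] := leP (normc z) 1.
  exists (normc z - 1); first by rewrite subr_gt0.
  move=> w w1; rewrite ltrBrDr => /le_lt_trans => /(_ (normc z)).
  rewrite ltxx => h; suff : false by []; apply: h.
  rewrite -{1}(subrK w z) (le_trans (le_normcD _ _))//.
  by rewrite -normcN opprB lerD2l.
(* A square is covered in place of the disc, being a product of segments; [Q] is vacuous off the
   disc. *)
have cK : compact ([set` `[-1 : R, 1]] `*` [set` `[-1 : R, 1]]).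
  by apply: compact_setX; exact: segment_compact.
pose Q (e : R) (p : R * R) :=
  normc (Complex p.1 p.2) <= 1 -> P e (Complex p.1 p.2).
have /compact_near_coveringP/(_ _ (0^'+) Q) := cK.
case.
  move=> [s t] _; have [e e0 eP] := Ploc (Complex s t).
  have e20 : 0 < e / 2 by rewrite divr_gt0.
  exists (ball s (e / 2) `*` ball t (e / 2), [set d | 0 < d < e]).
    split=> /=.
      by exists (ball s (e / 2), ball t (e / 2)) => //; split; exact: nbhsx_ballx.
    near=> d; apply/andP; split; near: d; [exact: nbhs_right_gt|exact: nbhs_right_lt].
  move=> [[s' t'] d] /= [[+ +] /andP[d0 de]].
  rewrite -!ball_normE/= => ss' tt' st1.
  apply: (Pmon e); first exact: ltW.
  apply: eP => //; rewrite (le_lt_trans (normc_le_ReIm _))//= [ltRHS]splitr.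
  by rewrite ltrD// distrC.
move=> e /= e0 eQ.
exists (e / 2); first by rewrite divr_gt0.
move=> z z1.
have e2 : 0 < e / 2 by rewrite divr_gt0.
have /eQ/(_ e2) : `|0 - e / 2| < e.
  by rewrite sub0r normrN gtr0_norm// gtr_pMr// invf_lt1// ltr1n.
have zK : (`[-1, 1] `*` `[-1, 1]) (complex.Re z, complex.Im z).
  by split=> /=; rewrite in_itv/= -ler_norml; apply: le_trans z1;
    [exact: normc_Re_le|exact: normc_Im_le].
by move=> /(_ _ zK); rewrite /Q; case: z z1 {zK} => s t /= z1; exact.
Unshelve. all: by end_near. Qed.

End Complex.

(** * The ring of bounded operators and its norm *)

Section OperatorAlgebra.
Variable R : realType.
Implicit Types E F G : normedModType R[i].

Lemma rnormZc E (a : R[i]) (x : E) : rnorm (a *: x) = normc a * rnorm x.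
Proof. exact: rnormZ. Qed.

Lemma ler_rnormB E (x y : E) : rnorm x - rnorm y <= rnorm (x - y).
Proof. by rewrite lerBlDr -{1}(subrK y x) ler_rnormD. Qed.

Lemma rnorm_distC E (x y : E) : rnorm (x - y) = rnorm (y - x).
Proof. by rewrite -opprB rnormN. Qed.

Lemma ler_rnorm_sum E (I : Type) (s : seq I) (P : pred I) (f : I -> E) :
  rnorm (\sum_(i <- s | P i) f i) <= \sum_(i <- s | P i) rnorm (f i).
Proof.
elim/big_rec2: _ => [|i x y _ ih]; first by rewrite rnorm0.
by rewrite (le_trans (ler_rnormD _ _))// lerD2l.
Qed.

Lemma rnorm_opnorm E F (A : bop E F) : rnorm A = opnorm A.
Proof. by []. Qed.

Lemma bop_addE E F (A B : bop E F) x : (A + B) x = A x + B x.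
Proof. by []. Qed.
Lemma bop_oppE E F (A : bop E F) x : (- A) x = - A x.
Proof. by []. Qed.
Lemma bop_subE E F (A B : bop E F) x : (A - B) x = A x - B x.
Proof. by []. Qed.
Lemma bop_scaleE E F (a : R[i]) (A : bop E F) x : (a *: A) x = a *: A x.
Proof. by []. Qed.

Lemma bop_sumE E F (I : Type) (s : seq I) (P : pred I) (f : I -> bop E F) x :
  (\sum_(i <- s | P i) f i) x = \sum_(i <- s | P i) f i x.
Proof.
elim: s => [|i s ih]; first by rewrite !big_nil.
by rewrite !big_cons; case: ifP => _; rewrite -ih.
Qed.

Section Ring.
Variable E : normedModType R[i].
Let mulA : associative (@bop_comp R E E E).
Proof. by move=> A B C; exact: bopP. Qed.
Let mul1 : left_id (bop_id E) (@bop_comp R E E E).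
Proof. by move=> A; exact: bopP. Qed.
Let mulr1 : right_id (bop_id E) (@bop_comp R E E E).
Proof. by move=> A; exact: bopP. Qed.
Let mulDl : left_distributive (@bop_comp R E E E) +%R.
Proof. by move=> A B C; exact: bopP. Qed.
Let mulDr : right_distributive (@bop_comp R E E E) +%R.
Proof. by move=> A B C; apply: bopP => x; exact: linearD. Qed.

(** The ring may be zero: [1 = 0] when [E] is trivial. *)
HB.instance Definition _ := GRing.Zmodule_isPzRing.Build (bop E E)
  mulA mul1 mulr1 mulDl mulDr.
End Ring.

Lemma bop_scalerAl E (a : R[i]) (A B : bop E E) : a *: A * B = a *: (A * B).
Proof. exact: bopP. Qed.

Lemma bop_scalerAr E (a : R[i]) (A B : bop E E) : A * (a *: B) = a *: (A * B).
Proof. by apply: bopP => x; rewrite [LHS]linearZ. Qed.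

Lemma bop_exprZn E (a : R[i]) (A : bop E E) n : (a *: A) ^+ n = a ^+ n *: A ^+ n.
Proof.
elim: n => [|n ih]; first by rewrite !expr0 scale1r.
by rewrite !exprS ih bop_scalerAl bop_scalerAr scalerA.
Qed.

Lemma bop_mulE E (A B : bop E E) x : (A * B) x = A (B x).
Proof. by []. Qed.
Lemma bop_1E E x : (1 : bop E E) x = x.
Proof. by []. Qed.
Lemma bop_expE E (S : bop E E) n : bop_exp S n = S ^+ n.
Proof. by elim: n => //= n ih; rewrite exprS -ih. Qed.

Lemma opnormM E (A B : bop E E) : opnorm (A * B) <= opnorm A * opnorm B.
Proof.
apply: opnorm_le => [|x]; first by rewrite mulr_ge0 ?opnorm_ge0.
by rewrite bop_mulE (le_trans (opnormP _ _))// -mulrA ler_wpM2l ?opnorm_ge0 ?opnormP.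
Qed.

Lemma opnorm1 E : opnorm (1 : bop E E) <= 1.
Proof. by apply: opnorm_le => // x; rewrite mul1r. Qed.

Lemma opnormX E (A : bop E E) n : opnorm (A ^+ n) <= opnorm A ^+ n.
Proof.
elim: n => [|n ih]; first by rewrite !expr0 opnorm1.
by rewrite !exprS (le_trans (opnormM _ _))// ler_wpM2l ?opnorm_ge0.
Qed.

Lemma opnormD E F (A B : bop E F) : opnorm (A + B) <= opnorm A + opnorm B.
Proof. exact: (@ler_rnormD _ (bop E F) A B). Qed.

Lemma opnormB E F (A B : bop E F) : opnorm (A - B) <= opnorm A + opnorm B.
Proof. by rewrite (le_trans (opnormD _ _))// -[opnorm (- B)]rnorm_opnorm rnormN. Qed.

Lemma opnorm_distC E F (A B : bop E F) : opnorm (A - B) = opnorm (B - A).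
Proof. exact: (@rnorm_distC (bop E F)). Qed.

Lemma opnormZ E F (a : R[i]) (A : bop E F) : opnorm (a *: A) = normc a * opnorm A.
Proof. exact: (@rnormZc (bop E F)). Qed.

Lemma opnormX_contr E (A : bop E E) n : opnorm A <= 1 -> opnorm (A ^+ n) <= 1.
Proof. by move=> A1; rewrite (le_trans (opnormX _ _))// exprn_ile1// opnorm_ge0. Qed.

Definition bop_ring_inv E (A B : bop E E) := A * B = 1 /\ B * A = 1.

Lemma bop_invertibleP E (A : bop E E) :
  bop_invertible A <-> exists B, bop_ring_inv A B.
Proof. by split=> [[B AB BA]|[B [AB BA]]]; exists B. Qed.

End OperatorAlgebra.

(** * Spectral radius and Neumann series *)

Section SpectralRadius.
Variables (R : realType) (E : normedModType R[i]).
Implicit Types (X Y Z : bop E E) (l : R[i]).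

Lemma opnorm_inv_le (A B : bop E E) (e : R) : 0 < e ->
  (forall u, e * rnorm u <= rnorm (A u)) -> A * B = 1 -> opnorm B <= e^-1.
Proof.
move=> e0 Ae AB; apply: opnorm_le => [|x]; first by rewrite invr_ge0 ltW.
rewrite mulrC ler_pdivlMr// mulrC (le_trans (Ae _))//.
by rewrite -bop_mulE AB.
Qed.

(** The summand 1 keeps the denominator positive when [E] is trivial and [B = 0]. *)
Lemma opnorm_inv_ge (A B : bop E E) u :
  B * A = 1 -> (opnorm B + 1)^-1 * rnorm u <= rnorm (A u).
Proof.
move=> BA; have B1 : 0 < opnorm B + 1 by rewrite ltr_wpDl ?opnorm_ge0.
rewrite mulrC ler_pdivrMr// -{1}[u](bop_1E) -BA bop_mulE.
by rewrite (le_trans (opnormP _ _))// mulrC ler_wpM2l ?rnorm_ge0// lerDl.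
Qed.

(** The lower bound [N] at one [l] survives, halved, on a disc about [l]; compactness makes it
    uniform. *)
Lemma resolvent_bounded X :
  (forall l, normc l <= 1 -> exists Z, bop_ring_inv (1 - l *: X) Z) ->
  exists2 e : R, 0 < e & forall l, normc l <= 1 ->
    forall u, e * rnorm u <= rnorm ((1 - l *: X) u).
Proof.
move=> Xinv; pose P (e : R) l := forall u, e * rnorm u <= rnorm ((1 - l *: X) u).
apply: (@closed_disc_uniform _ P) => [e d z de Pe u|l /Xinv[Z [_ ZX]]].
  by rewrite (le_trans _ (Pe u))// ler_wpM2r ?rnorm_ge0.
pose N := (opnorm Z + 1)^-1.
have N0 : 0 < N by rewrite invr_gt0 ltr_wpDl ?opnorm_ge0.
have X1 : 0 < opnorm X + 1 by rewrite ltr_wpDl ?opnorm_ge0.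
(* One parameter serves both as lower bound (first entry) and as radius (second entry, which keeps
   the perturbation below [N / 2]). *)
exists (Num.min (N / 2) (N / 2 / (opnorm X + 1))).
  by rewrite lt_min !divr_gt0.
move=> w w1 wl u.
have -> : (1 - w *: X) u = (1 - l *: X) u - (w - l) *: X u.
  by rewrite !(bop_addE, bop_oppE, bop_scaleE) scalerBl opprB addrA subrK.
rewrite (le_trans _ (ler_rnormB _ _))// rnormZc.
have h1 := opnorm_inv_ge u ZX; rewrite -/N in h1.
have h2 : normc (w - l) * rnorm (X u) <= N / 2 * rnorm u.
  rewrite (@le_trans _ _ (N / 2 / (opnorm X + 1) * (opnorm X * rnorm u)))//.
    rewrite ler_pM ?opnormP ?rnorm_ge0//; first exact: normc_ge0.
    by rewrite (le_trans (ltW wl))// ge_min lexx orbT.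
  rewrite mulrA ler_wpM2r ?rnorm_ge0// -mulrA ler_piMr ?divr_ge0 ?(ltW N0)//.
  by rewrite mulrC ler_pdivrMr// mul1r lerDl.
have h3 : Num.min (N / 2) (N / 2 / (opnorm X + 1)) * rnorm u <= N / 2 * rnorm u.
  by rewrite ler_wpM2r ?rnorm_ge0// ge_min lexx.
by rewrite (le_trans h3)//; lra.
Qed.

(** Partial fractions: [1 / (1 - W^2) = (1 / (1 - W) + 1 / (1 + W)) / 2]. *)
Lemma resolvent_sqr Y l Z Z' : bop_ring_inv (1 - l *: Y) Z ->
  bop_ring_inv (1 - (- l) *: Y) Z' ->
  bop_ring_inv (1 - l ^+ 2 *: Y ^+ 2) (2^-1 *: (Z + Z')).
Proof.
rewrite scaleNr opprK -bop_exprZn => -[YZ ZY] [YZ' ZY'].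
set W := l *: Y in YZ ZY YZ' ZY' *.
have WE : 1 - W ^+ 2 = (1 - W) * (1 + W).
  by rewrite mulrDr mulr1 mulrBl mul1r expr2 addrA subrK.
have WE' : 1 - W ^+ 2 = (1 + W) * (1 - W).
  by rewrite mulrBr mulr1 mulrDl mul1r expr2 opprD addrA addrK.
have two : 2^-1 *: ((1 + W) + (1 - W)) = 1.
  by rewrite addrACA subrr addr0 -mulr2n -[X in _ *: X]scaler_nat scalerA mulVf ?pnatr_eq0// scale1r.
split.
  rewrite bop_scalerAr mulrDr {1}WE' WE -!mulrA YZ YZ' !mulr1.
  by rewrite -[RHS]two.
by rewrite bop_scalerAl mulrDl {1}WE WE' !mulrA ZY ZY' !mul1r.
Qed.

(** Ranging over the whole disc makes both square roots of every [l] available. *)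
Definition resolvent_close (e : R) Y Y' := forall l, normc l <= 1 ->
  exists Z Z', [/\ bop_ring_inv (1 - l *: Y) Z, bop_ring_inv (1 - l *: Y') Z'
    & opnorm (Z - Z') <= e].

(** The resolvent of the square at [l] is the mean of the resolvents at the two square roots of [l],
    so [e] does not grow. *)
Lemma resolvent_close_sqr e Y Y' :
  resolvent_close e Y Y' -> resolvent_close e (Y ^+ 2) (Y' ^+ 2).
Proof.
move=> YY' l l1; have s2 := sqr_sqrtc l.
have s1 : normc (sqrtc l) <= 1.
  have s0 : 0 <= normc (sqrtc l) by exact: normc_ge0.
  by rewrite -(@expr_le1 _ 2)// expr2 -normcM -expr2 s2.
have [Z1 [Z1' [h1 h1' d1]]] := YY' _ s1.
have [|Z2 [Z2' [h2 h2' d2]]] := YY' (- sqrtc l); first by rewrite normcN.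
exists (2^-1 *: (Z1 + Z2)), (2^-1 *: (Z1' + Z2')); rewrite -s2.
split; [exact: resolvent_sqr|exact: resolvent_sqr|].
rewrite -scalerBr opprD addrACA opnormZ.
have -> : normc (2^-1 : R[i]) = 2^-1.
  apply: complexI; rewrite -normr_normc gtr0_norm ?invr_gt0// fmorphV.
  by rewrite rmorph_nat.
rewrite mulrC ler_pdivrMr// mulr2n mulrDr mulr1.
by rewrite (le_trans (opnormD _ _))// lerD.
Qed.

Lemma resolvent_close_pow2 e Y Y' k :
  resolvent_close e Y Y' -> resolvent_close e (Y ^+ (2 ^ k)) (Y' ^+ (2 ^ k)).
Proof.
move=> YY'; elim: k => [|k ih]; first by rewrite !expr1.
by rewrite expnS mulnC !exprM; exact: resolvent_close_sqr.
Qed.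

(** At [l = 1], [Z - 1 = Z * Y] has norm at most 1/15, so [Z' - 1] has norm at most 2/15, and
    [Y' = (Z' - 1) * (1 - Y')] then has norm at most 2/13. *)
Lemma resolvent_small Y Y' : resolvent_close 15^-1 Y Y' ->
  opnorm Y <= 16^-1 -> opnorm Y' <= 4^-1.
Proof.
move=> YY' Y1.
have [|Z [Z' [[_ ZY] [_ ZY'] ZZ']]] := YY' 1; first by rewrite normc1.
rewrite !scale1r in ZY ZY'.
have ZE (A B : bop E E) : A * (1 - B) = 1 -> A - 1 = A * B.
  by move=> h; rewrite -h mulrBr mulr1 opprB addrC subrK.
have Z1 : opnorm (Z - 1) <= 15^-1.
  have := opnormM Z Y; rewrite -(ZE _ _ ZY) => h.
  have : opnorm Z <= opnorm (Z - 1) + 1.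
    by rewrite -{1}(subrK 1 Z) (le_trans (opnormD _ _))// lerD2l opnorm1.
  have := opnorm_ge0 Z; have := opnorm_ge0 Y; nra.
have Z'1 : opnorm (Z' - 1) <= 2 / 15.
  rewrite -(subrK Z Z') -addrA (le_trans (opnormD _ _))// opnorm_distC.
  lra.
have : opnorm Y' <= opnorm (Z' - 1) + opnorm (Z' - 1) * opnorm Y'.
  have {1}-> : Y' = (Z' - 1) - (Z' - 1) * Y'.
    by rewrite mulrBl mul1r (ZE _ _ ZY') opprB addrC subrK.
  by rewrite (le_trans (opnormB _ _))// lerD2l opnormM.
have := opnorm_ge0 Y'; nra.
Qed.

(* The spectral radius of X is less than 1.  The resolvents of r X and of its
   powers of exponent 2 ^ k are equicontinuous in r, so that smallness of some
   (r X) ^ (2 ^ k) propagates from r = 0 to r = 1 in steps of fixed length. *)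
Lemma small_power X :
  (forall l, normc l <= 1 -> exists Z, bop_ring_inv (1 - l *: X) Z) ->
  exists k, opnorm (X ^+ (2 ^ k)) <= 4^-1.
Proof.
move=> Xinv; have [e e0 Xe] := resolvent_bounded Xinv.
pose small (r : R) := exists k, opnorm ((r%:C *: X) ^+ (2 ^ k)) <= 4^-1.
(* [K] bounds [Z * X * Z'] for resolvents [Z], [Z'] of norm at most [e^-1]; the step length [d] then
   keeps [Z - Z'] within [15^-1]. *)
pose K := e ^- 2 * opnorm X.
have K0 : 0 <= K by rewrite mulr_ge0 ?opnorm_ge0// invr_ge0 exprn_ge0// ltW.
pose d := 15^-1 / (K + 1).
have d0 : 0 < d by rewrite divr_gt0// ltr_wpDl.
have step r r' : 0 <= r <= 1 -> 0 <= r' <= 1 -> `|r - r'| <= d -> small r -> small r'.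
  move=> r01 r01' rr' [k rk]; exists k.+1.
  have normR (s : R) l : 0 <= s <= 1 -> normc l <= 1 -> normc (l * s%:C) <= 1.
    move=> /andP[s0 s1] l1; rewrite normcM mulr_ile1 ?normc_ge0//.
    by rewrite normcR ger0_norm.
  (* One more squaring turns the bound 1/4 at [r] into the 1/16 required here, and 1/4 comes back at
     [r']. *)
  apply: (@resolvent_small ((r%:C *: X) ^+ (2 ^ k.+1))); last first.
    rewrite expnSr exprM (le_trans (opnormX _ _))//.
    by have := opnorm_ge0 ((r%:C *: X) ^+ (2 ^ k)); nra.
  apply: resolvent_close_pow2 => l l1; rewrite !scalerA.
  have [Z [XZ ZX]] := Xinv _ (normR _ _ r01 l1).
  have [Z' [XZ' ZX']] := Xinv _ (normR _ _ r01' l1).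
  exists Z, Z'; split => //.
  (* The resolvent identity. *)
  have -> : Z - Z' = (l * (r - r')%:C) *: (Z * X * Z').
    have -> : Z - Z' = Z * ((1 - (l * r'%:C) *: X) - (1 - (l * r%:C) *: X)) * Z'.
      by rewrite mulrBr mulrBl ZX mul1r -mulrA XZ' mulr1.
    rewrite opprB addrCA addrAC subrr add0r -scalerBl -mulrBr -rmorphB/=.
    by rewrite bop_scalerAr bop_scalerAl.
  have ZZ : opnorm (Z * X * Z') <= K.
    have z1 := opnorm_inv_le e0 (Xe _ (normR _ _ r01 l1)) XZ.
    have z2 := opnorm_inv_le e0 (Xe _ (normR _ _ r01' l1)) XZ'.
    rewrite (le_trans (opnormM _ _))// (le_trans (ler_pM _ _ (opnormM _ _) z2))//.
    - exact: opnorm_ge0.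
    - exact: opnorm_ge0.
    rewrite /K -exprVn expr2 mulrAC ler_wpM2r ?opnorm_ge0//.
    by rewrite ler_wpM2r// invr_ge0 ltW.
  rewrite opnormZ normcM.
  rewrite normcR.
  have h : `|r - r'| * K <= 15^-1.
    rewrite (le_trans (ler_wpM2r K0 rr'))// /d mulrAC -mulrA ler_piMr//.
    by rewrite ler_pdivrMr ?ltr_wpDl// mul1r lerDl.
  by rewrite (le_trans _ h)// ler_pM ?mulr_ge0 ?normc_ge0 ?opnorm_ge0// ler_piMl.
have [n nd] : exists n : nat, n.+1%:R^-1 < d.
  exists (Num.truncn d^-1); rewrite invf_plt ?posrE//.
  by rewrite truncnS_gt.
pose q (j : nat) : R := j%:R / n.+1%:R.
have : forall j, (j <= n.+1)%N -> small (q j).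
  have q01 j : (j <= n.+1)%N -> 0 <= q j <= 1.
    move=> jn; rewrite /q divr_ge0 ?ler0n// andTb ler_pdivrMr ?ltr0n//.
    by rewrite mul1r ler_nat.
  elim=> [_|j ih jn].
    by exists 0%N; rewrite /q mul0r scale0r expr1 -rnorm_opnorm rnorm0.
  apply: step (q01 _ (ltnW jn)) (q01 _ jn) _ (ih (ltnW jn)).
  by rewrite distrC -mulrBl -natrB// subSnn mul1r ger0_norm ?invr_ge0// ltW.
move=> /(_ _ (leqnn _)); rewrite /q divff ?pnatr_eq0// => -[k].
by rewrite scale1r; exists k.
Qed.

End SpectralRadius.

Section Neumann.
Variable R : realType.

(** Surjectivity gives a right inverse by choice; the lower bound makes [A] injective, which forces
    that inverse to be linear, and bounds it by [e^-1]. *)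
Lemma bop_ring_inv_ex (E : normedModType R[i]) (A : bop E E) (e : R) : 0 < e ->
  (forall u, e * rnorm u <= rnorm (A u)) -> (forall y, exists x, A x = y) ->
  exists B, bop_ring_inv A B.
Proof.
move=> e0 Ae /choice[B AB].
have Ainj u v : A u = A v -> u = v.
  move=> uv; apply/eqP; rewrite -subr_eq0; apply/eqP/rnorm0_eq0/eqP.
  rewrite eq_le rnorm_ge0 andbT -(ler_pM2l e0) mulr0 (le_trans (Ae _))//.
  by rewrite linearB/= uv subrr rnorm0.
have Blin : linear B.
  by move=> a x y; apply: Ainj; rewrite AB linearP/= !AB.
pose Bl : {linear E -> E} := HB.pack B (GRing.isLinear.Build R[i] E E *:%R B Blin).
have Bcont : continuous B.
  apply: (@bounded_linear_continuous _ _ _ Bl); apply/linear_boundedP.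
  near=> r => x /=; rewrite (@le_trans _ _ ((e^-1)%:C * `|x|))//.
    rewrite !normE -rmorphM/= lecR -ler_pdivrMl ?invr_gt0// invrK.
    by rewrite (le_trans (Ae _))// AB.
  rewrite ler_wpM2r//; near: r; apply: nbhs_pinfty_ge.
  by rewrite ger0_real// ler0c invr_ge0 ltW.
exists (Bop Blin Bcont); split; apply: bopP => x; first exact: AB.
by apply: Ainj; rewrite bop_mulE AB.
Unshelve. all: by end_near. Qed.

Lemma cvg_rnormP (V : normedModType R[i]) (u : nat -> V) (x : V) :
  u @ \oo --> x <-> (rnorm (u n - x) @[n --> \oo] --> (0 : R)).
Proof.
split=> [/cvgrPdist_lt ux|/cvgrPdist_lt ux].
  apply/cvgrPdist_lt => e e0; have := ux e%:C; rewrite ltcR => /(_ e0).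
  apply: filterS => n; rewrite normE ltcR sub0r normrN ger0_norm ?rnorm_ge0//.
  by rewrite rnorm_distC.
apply/cvgrPdist_lt => e e0.
have eE : e = (complex.Re e)%:C by rewrite RRe_real// gtr0_real.
have := ux (complex.Re e); rewrite -ltcR -eE => /(_ e0).
apply: filterS => n; rewrite sub0r normrN ger0_norm ?rnorm_ge0//.
by rewrite rnorm_distC eE normE ltcR.
Qed.

Variable E : completeNormedModType R[i].
Implicit Types A B D T : bop E E.

Lemma geometric_cvg (u : nat -> E) (C q : R) : 0 <= q < 1 ->
  (forall n, rnorm (u n.+1 - u n) <= C * q ^+ n) -> exists x : E, u @ \oo --> x.
Proof.
move=> /andP[q0 q1] uC.
have q1' : 0 < 1 - q by rewrite subr_gt0.
have C0 : 0 <= C by have := le_trans (rnorm_ge0 _) (uC 0%N); rewrite expr0 mulr1.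
have um n k : rnorm (u (n + k)%N - u n) <= C * q ^+ n / (1 - q).
  (* The exact geometric partial sum is what the induction can carry; the factor [1 - q ^+ k] is
     dropped afterwards. *)
  have : rnorm (u (n + k)%N - u n) <= C * q ^+ n * (1 - q ^+ k) / (1 - q).
    elim: k => [|k ih]; first by rewrite addn0 !subrr rnorm0 mulr0 mul0r.
    rewrite addnS -(subrKA (u (n + k)%N)) (le_trans (ler_rnormD _ _))//.
    rewrite (le_trans (lerD (uC _) ih))// le_eqVlt; apply/orP; left; apply/eqP.
    by rewrite exprD exprS; field; rewrite gt_eqF.
  move=> /le_trans; apply; rewrite ler_wpM2r ?invr_ge0 ?(ltW q1')//.
  by rewrite ler_piMr ?mulr_ge0 ?exprn_ge0// lerBlDr lerDl exprn_ge0.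
have qC (e : R) : 0 < e -> exists n, C * q ^+ n / (1 - q) < e.
  move=> e0; have [n _ nP] : \forall n \near \oo, q ^+ n < e * (1 - q) / (C + 1).
    have q1n : `|q| < 1 by rewrite ger0_norm.
    have := cvgr_lt _ (cvg_expr q1n); apply.
    by rewrite divr_gt0 ?mulr_gt0// ltr_wpDl.
  exists n; rewrite ltr_pdivrMr// (@le_lt_trans _ _ ((C + 1) * q ^+ n))//.
    by rewrite ler_wpM2r ?exprn_ge0// lerDl.
  by rewrite mulrC -ltr_pdivlMr ?ltr_wpDl// nP/=.
apply/cvg_ex/cauchy_cvgP/cauchy_exP => e e0.
have eE : e = (complex.Re e)%:C by rewrite RRe_real// gtr0_real.
have [|n ne] := qC (complex.Re e); first by rewrite -ltcR -eE.
exists (u n), n => // m /= nm; rewrite -ball_normE/= eE normE ltcR.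
by rewrite rnorm_distC (le_lt_trans _ ne)// -(subnKC nm) um.
Qed.

(** [1 - T] is bounded below by [1 - opnorm T], and it is onto because the Neumann series applied to
    [y] converges to a preimage of [y]. *)
Lemma neumann T : opnorm T < 1 -> exists B, bop_ring_inv (1 - T) B.
Proof.
move=> T1.
have T0 : 0 < 1 - opnorm T by rewrite subr_gt0.
apply: (bop_ring_inv_ex T0) => [u|y].
  rewrite bop_subE bop_1E mulrBl mul1r (le_trans _ (ler_rnormB _ _))//.
  by rewrite lerD2l lerN2 opnormP.
pose u n := (\sum_(i < n) T ^+ i) y.
have [|n|x ux] := @geometric_cvg u (rnorm y) (opnorm T).
- by rewrite opnorm_ge0.
- rewrite /u big_ord_recr/= addrAC subrr add0r mulrC.
  by rewrite (le_trans (opnormP _ _))// ler_wpM2r ?rnorm_ge0// opnormX.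
exists x.
have h1 : (1 - T) \o u @ \oo --> (1 - T) x.
  by apply: continuous_cvg => //; exact: bop_continuous.
have h2 : (1 - T) \o u @ \oo --> y.
  apply/cvg_rnormP.
  have eT n : rnorm (((1 - T) \o u) n - y) <= opnorm T ^+ n * rnorm y.
    have e : (1 - T) * (\sum_(i < n) T ^+ i) = 1 - T ^+ n.
      by rewrite -[1 - T]opprB mulNr -subrX1 opprB.
    have -> : ((1 - T) \o u) n = y - (T ^+ n) y.
      by transitivity (((1 - T) * (\sum_(i < n) T ^+ i)) y); rewrite // e.
    rewrite addrAC subrr add0r rnormN.
    by rewrite (le_trans (opnormP _ _))// ler_wpM2r ?rnorm_ge0// opnormX.
  apply: (@squeeze_cvgr _ _ _ _ (fun=> 0) (fun n => opnorm T ^+ n * rnorm y)).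
  - by near=> n; rewrite rnorm_ge0 eT.
  - exact: cvg_cst.
  rewrite -[X in _ --> X](mul0r (rnorm y)); apply: cvgMl.
  by apply: cvg_expr; rewrite ger0_norm ?opnorm_ge0.
apply: cvg_unique h1 h2; exact: norm_hausdorff.
Unshelve. all: by end_near. Qed.

Lemma bop_ring_inv_mul A B A' B' : bop_ring_inv A A' -> bop_ring_inv B B' ->
  bop_ring_inv (A * B) (B' * A').
Proof.
move=> [AA' A'A] [BB' B'B]; split.
  by rewrite mulrA -(mulrA A) BB' mulr1.
by rewrite mulrA -(mulrA B') A'A mulr1.
Qed.

(** Factor [A - D = A * (1 - B * D)]. *)
Lemma bop_ring_inv_perturb A B D : bop_ring_inv A B -> opnorm B * opnorm D < 1 ->
  exists C, bop_ring_inv (A - D) C.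
Proof.
move=> [AB BA] BD; have [|C C1] := @neumann (B * D).
  exact: le_lt_trans (opnormM _ _) BD.
exists (C * B); have -> : A - D = A * (1 - B * D).
  by rewrite mulrBr mulr1 mulrA AB mul1r.
exact: bop_ring_inv_mul.
Qed.

End Neumann.

(** * Scalar polynomials of an operator *)

Section PolynomialCalculus.
Variables (R : realType) (E : normedModType R[i]).
Implicit Types (T : bop E E) (p q : {poly R[i]}).

Definition peval T p : bop E E := \sum_(i < size p) p`_i *: T ^+ i.

(** Padding with zero coefficients gives polynomials of different sizes a common range of
    summation. *)
Lemma pevalE T p n : (size p <= n)%N -> peval T p = \sum_(i < n) p`_i *: T ^+ i.
Proof.
move=> pn; rewrite /peval (big_ord_widen n (fun i => p`_i *: T ^+ i) pn).
rewrite [RHS](bigID (fun i : 'I_n => (i < size p)%N))/= [X in _ + X]big1 ?addr0//.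
by move=> i; rewrite -leqNgt => ip; rewrite nth_default// scale0r.
Qed.

Lemma pevalD T p q : peval T (p + q) = peval T p + peval T q.
Proof.
rewrite (pevalE _ (size_polyD _ _)) (pevalE _ (leq_maxl (size p) (size q))).
rewrite (pevalE _ (leq_maxr (size p) (size q))) -big_split/=.
by apply: eq_bigr => i _; rewrite coefD scalerDl.
Qed.

Lemma pevalZ T c p : peval T (c *: p) = c *: peval T p.
Proof.
rewrite (pevalE _ (size_scale_leq _ _)) scaler_sumr.
by apply: eq_bigr => i _; rewrite coefZ scalerA.
Qed.

Lemma pevalB T p q : peval T (p - q) = peval T p - peval T q.
Proof. by rewrite -scaleN1r pevalD pevalZ scaleN1r. Qed.

Lemma pevalXM T p : peval T ('X * p) = T * peval T p.
Proof.
rewrite (@pevalE _ _ (size p).+1); last first.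
  by rewrite (leq_trans (size_polyMleq _ _))// size_polyX.
rewrite big_ord_recl coefXM eqxx scale0r add0r mulr_sumr.
by apply: eq_bigr => i _; rewrite coefXM/= exprS bop_scalerAr.
Qed.

Lemma peval0 T : peval T 0 = 0.
Proof. by rewrite /peval size_poly0 big_ord0. Qed.

Lemma pevalC T c : peval T c%:P = c *: (1 : bop E E).
Proof.
by rewrite (pevalE _ (size_polyC_leq1 _)) big_ord_recl big_ord0 addr0 coefC eqxx.
Qed.

Lemma pevalX T : peval T 'X = T.
Proof. by rewrite -['X]mulr1 pevalXM pevalC scale1r mulr1. Qed.

Lemma pevalM T p q : peval T (p * q) = peval T p * peval T q.
Proof.
elim/poly_ind: p => [|p c ih]; first by rewrite mul0r !peval0 mul0r.
rewrite mulrDl !pevalD -[p * 'X]mulrC -mulrA !pevalXM ih mulrDl mulrA.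
by rewrite mul_polyC pevalZ pevalC bop_scalerAl mul1r.
Qed.

Lemma pevalXn T p n : peval T (p ^+ n) = peval T p ^+ n.
Proof.
elim: n => [|n ih]; first by rewrite !expr0 pevalC scale1r.
by rewrite !exprS pevalM ih.
Qed.

End PolynomialCalculus.

(** * The peak polynomial *)

Section Regular.
Variable R : realType.

Lemma sqr_normc_ReIm (z : R[i]) :
  normc z ^+ 2 = complex.Re z ^+ 2 + complex.Im z ^+ 2.
Proof. by case: z => s t; rewrite /= sqr_sqrtr// addr_ge0// sqr_ge0. Qed.

Lemma normcX (z : R[i]) n : normc (z ^+ n) = normc z ^+ n.
Proof.
elim: n => [|n ih]; first by rewrite !expr0 normc1.
by rewrite !exprS normcM ih.
Qed.

Lemma ler_normc_sqr (z w : R[i]) : (normc z <= normc w) = (normc z ^+ 2 <= normc w ^+ 2).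
Proof. by rewrite ler_pXn2r// nnegrE normc_ge0. Qed.

Lemma bernoulli_le (e : R) m : 0 <= e <= 1 -> 1 - m%:R * e <= (1 - e) ^+ m.
Proof.
move=> /andP[e0 e1]; elim: m => [|m ih]; first by rewrite mul0r subr0 expr0.
have e1' : 0 <= 1 - e by rewrite subr_ge0.
rewrite exprS (le_trans _ (ler_wpM2l e1' ih))// -natr1.
have : 0 <= m%:R * e ^+ 2 by rewrite mulr_ge0// sqr_ge0.
by lra.
Qed.

Variables (H : completeNormedModType R[i]) (S : bop H H).
Hypothesis S1 : opnorm S <= 1.
Hypothesis specS : spectrum S `&` unit_circle R `<=` [set 1].

(** The resolvent set of [S]. *)
Definition regular l := exists B, bop_ring_inv (l *: (1 : bop H H) - S) B.

Lemma regular_circle l : normc l = 1 -> l != 1 -> regular l.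
Proof.
move=> l1 /eqP ln1; apply/bop_invertibleP; apply: contrapT => Sl; apply: ln1.
by apply: (@specS l); split; [exact: Sl|rewrite /unit_circle/= normr_normc l1].
Qed.

Lemma scalar_inv (l : R[i]) : l != 0 -> bop_ring_inv (l *: (1 : bop H H)) (l^-1 *: (1 : bop H H)).
Proof.
by move=> l0; split; rewrite bop_scalerAl mul1r scalerA ?mulfV ?mulVf// scale1r.
Qed.

Lemma regular_gt1 l : 1 < normc l -> regular l.
Proof.
move=> l1; have l0 : l != 0.
  by apply: contraTneq l1 => ->; rewrite normc0 ltNge ler01.
apply: (bop_ring_inv_perturb (scalar_inv l0)); rewrite opnormZ normcV.
rewrite -mulrA mulrC ltr_pdivrMr ?(lt_trans ltr01)// mul1r (le_lt_trans _ l1)//.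
by rewrite mulr_ile1 ?opnorm_ge0// opnorm1.
Qed.

Lemma regular_open l : regular l ->
  exists2 e : R, 0 < e & forall w, normc (w - l) < e -> regular w.
Proof.
move=> [B lB]; have B1 : 0 < opnorm B + 1 by rewrite ltr_wpDl ?opnorm_ge0.
exists (opnorm B + 1)^-1; first by rewrite invr_gt0.
move=> w wl; rewrite /regular.
have -> : w *: (1 : bop H H) - S = (l *: (1 : bop H H) - S) - (l - w) *: (1 : bop H H).
  by rewrite scalerBl opprB [RHS]addrC addrA subrK.
apply: (bop_ring_inv_perturb lB); rewrite opnormZ -normcN opprB.
have := opnorm_ge0 B; have := @opnorm1 R H; have := opnorm_ge0 (1 : bop H H).
move=> o0 o1 B0.
have : normc (w - l) * opnorm (1 : bop H H) < (opnorm B + 1)^-1.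
  by rewrite (le_lt_trans _ wl)// ler_piMr ?normc_ge0.
move=> /ltW/(ler_wpM2l B0)/le_lt_trans; apply.
by rewrite ltr_pdivrMr// mul1r ltrDl.
Qed.

(** Locally there are three cases: near 1 the real part exceeds [x0]; near another point of the
    circle the resolvent set is open; inside the disc the modulus stays below 1. Compactness makes
    [e] uniform. *)
Lemma spectrum_gap (x0 : R) : x0 < 1 ->
  exists2 e : R, 0 < e & forall z, normc z <= 1 -> complex.Re z <= x0 ->
    regular z \/ normc z ^+ 2 <= 1 - e.
Proof.
move=> x01; pose P (e : R) z :=
  complex.Re z <= x0 -> regular z \/ normc z ^+ 2 <= 1 - e.
apply: (@closed_disc_uniform _ P) => [e d z de Pe /Pe[|ze]|z z1].
- by left.
- by right; rewrite (le_trans ze)// lerD2l lerN2.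
move: z1; rewrite le_eqVlt => /predU1P[z1|z1].
  have [->|zn1] := eqVneq z 1.
    exists (1 - x0) => [|w _ w1 wx0]; first by rewrite subr_gt0.
    have := normc_Re_le (w - 1); rewrite raddfB/= ler_norml => /andP[h _].
    by exfalso; lra.
  have [e e0 ze] := regular_open (regular_circle z1 zn1).
  by exists e => // w _ /ze wr _; left.
exists ((1 - normc z) / 2) => [|w w1 wz _]; first by rewrite divr_gt0// subr_gt0.
right; have : normc w <= normc (w - z) + normc z.
  by rewrite -{1}(subrK z w) le_normcD.
have := normc_ge0 w; rewrite expr2; nra.
Qed.

(** The radius is chosen so that on the unit circle [r <= |z - c|] amounts to [Re z <= x0]. A point
    of the closed unit disc with [r <= |z - c|] also has [Re z <= x0], so [spectrum_gap] applies to
    it. *)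
Lemma regular_off_disc (x0 : R) : x0 < 1 -> exists c r : R,
  [/\ 0 < c < 1, 1 - c < r, forall z, r <= normc (z - c%:C) -> regular z &
    forall z, normc z = 1 -> complex.Re z <= x0 -> r <= normc (z - c%:C)].
Proof.
move=> x01; have [e e0 eS] := spectrum_gap x01.
(* If [|z|^2 <= 1 - e] and [r <= |z - c|], then [e <= 2 * c * (x0 - Re z) <= 4 * c], which
   [c <= e / 8] excludes. *)
pose c := Num.min e 1 / 8.
have c0 : 0 < c by rewrite divr_gt0// lt_min e0/=.
have ce : c <= e / 8 by rewrite ler_wpM2r// ge_min lexx.
have c1 : c <= 1 / 8 by rewrite ler_wpM2r// ge_min lexx orbT.
have r0 : 0 <= 1 + c ^+ 2 - 2 * c * x0 by nra.
pose r := Num.sqrt (1 + c ^+ 2 - 2 * c * x0).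
have r2 : r ^+ 2 = 1 + c ^+ 2 - 2 * c * x0 by rewrite sqr_sqrtr.
have rge0 : 0 <= r by rewrite sqrtr_ge0.
have zc2 z : normc (z - c%:C) ^+ 2 = normc z ^+ 2 + c ^+ 2 - 2 * c * complex.Re z.
  rewrite !sqr_normc_ReIm; case: z => s t /=; ring.
have rP z : (r <= normc (z - c%:C)) = (r ^+ 2 <= normc (z - c%:C) ^+ 2).
  by rewrite ler_pXn2r// nnegrE normc_ge0.
exists c, r; split.
- by rewrite c0/=; lra.
- by rewrite ltNge; apply/negP => h; nra.
- move=> z; rewrite rP r2 zc2 => h.
  have [z1|] := leP (normc z) 1; last exact: regular_gt1.
  have z21 : normc z ^+ 2 <= 1 by rewrite exprn_ile1// normc_ge0.
  have zx0 : complex.Re z <= x0 by nra.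
  case: (eS z z1 zx0) => // ze; exfalso.
  have := le_trans (normc_Re_le z) z1; rewrite ler_norml => /andP[h1 h2].
  nra.
- move=> z z1 zx0; rewrite rP r2 zc2 z1.
  nra.
Qed.

End Regular.

Section PeakPolynomial.
Variable R : realType.

(* Apollonius: the points [a] and [b] of the real axis are inverse to each
   other with respect to the circle of centre [c] and radius [r]. *)
Lemma apollonius (c r k : R) (z : R[i]) : 0 < r -> 1 < k -> r <= normc (z - c%:C) ->
  normc ((c + r * k)%:C - z) <= k * normc ((c + r / k)%:C - z).
Proof.
move=> r0 k1 rz.
have k0 : 0 < k by rewrite (lt_trans ltr01).
have -> (w : R[i]) : k * normc w = normc (k%:C * w).
  by rewrite normcM normcR gtr0_norm.
rewrite ler_normc_sqr.
have : r ^+ 2 <= normc (z - c%:C) ^+ 2 by rewrite ler_pXn2r// nnegrE ?normc_ge0// ltW.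
rewrite !sqr_normc_ReIm; case: z {rz} => s t /=.
rewrite !(mul0r, addr0, subr0, sub0r, sqrrN, oppr0).
have -> : k * (c + r / k - s) = k * c + r - k * s by field; rewrite gt_eqF.
move=> h; rewrite -subr_ge0.
rewrite [leRHS](_ : _ = (k ^+ 2 - 1) * ((s - c) ^+ 2 + t ^+ 2 - r ^+ 2)); last ring.
by rewrite mulr_ge0 ?subr_ge0// exprn_ege1// ltW.
Qed.

(** The map [l -> (k - l) / (1 - l * k)] sends the closed unit disc outside the open one: the
    squared moduli differ by [(k^2 - 1) * (1 - |l|^2)]. *)
Lemma disc_mobius (k : R) (l : R[i]) : 1 < k -> normc l <= 1 ->
  normc (1 - l * k%:C) <= normc (k%:C - l).
Proof.
move=> k1 l1; have : normc l ^+ 2 <= 1 by rewrite exprn_ile1// normc_ge0.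
rewrite ler_normc_sqr !sqr_normc_ReIm {l1}; case: l => s t /=.
rewrite !(mul0r, mulr0, addr0, subr0, sub0r, sqrrN, oppr0, add0r) => h.
rewrite -subr_ge0.
rewrite [leRHS](_ : _ = (k ^+ 2 - 1) * (1 - (s ^+ 2 + t ^+ 2))); last ring.
by rewrite mulr_ge0 ?subr_ge0// exprn_ege1// ltW.
Qed.

Variables (H : completeNormedModType R[i]) (S : bop H H).
Hypothesis S1 : opnorm S <= 1.

Lemma peval_real_sub (a : R) : peval S (a%:C%:P - 'X) = a%:C *: (1 : bop H H) - S.
Proof. by rewrite pevalB pevalC pevalX. Qed.

(** The pencil is a multiple of [z - S] with [z - c = r * (k - l) / (1 - l * k)], a point outside
    the open disc of centre [c] and radius [r]. Hence [k * (a - S) / (b - S)] has its spectrum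
    inside the open unit disc. *)
Lemma pencil_inv (c r k : R) (l : R[i]) : 0 < r -> 1 < k ->
  (forall z, r <= normc (z - c%:C) -> regular S z) -> normc l <= 1 ->
  exists B, bop_ring_inv (((c + r * k)%:C *: (1 : bop H H) - S) -
     (l * k%:C) *: ((c + r / k)%:C *: (1 : bop H H) - S)) B.
Proof.
move=> r0 k1 reg l1; set b := (c + r * k)%:C; set a := (c + r / k)%:C.
have k0 : 0 < k by rewrite (lt_trans ltr01).
have -> : b *: (1 : bop H H) - S - (l * k%:C) *: (a *: (1 : bop H H) - S) =
    (b - l * k%:C * a) *: (1 : bop H H) - (1 - l * k%:C) *: S.
  rewrite scalerBr scalerA !scalerBl scale1r.
  by rewrite !opprB addrACA [RHS]addrACA; congr (_ + _); rewrite addrC.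
(* Here [z] would be infinite, and the pencil is the nonzero scalar [b - a]. *)
have [lk|lk] := eqVneq (1 - l * k%:C) 0.
  rewrite lk scale0r subr0; move/eqP: lk; rewrite subr_eq0 => /eqP <-.
  rewrite mul1r; eexists; apply: scalar_inv.
  rewrite /a /b -rmorphB/= fmorph_eq0 opprD addrACA subrr add0r.
  rewrite gt_eqF// -mulrBr mulr_gt0// subr_gt0 (lt_trans _ k1)//.
  by rewrite invf_lt1.
pose z := (b - l * k%:C * a) / (1 - l * k%:C).
have [|B zB] := reg z.
  have -> : z - c%:C = r%:C * ((k%:C - l) / (1 - l * k%:C)).
    have kk : k%:C != 0 :> R[i] by rewrite fmorph_eq0 gt_eqF.
    rewrite /z /a /b !rmorphD !rmorphM fmorphV/=.
    by field; rewrite kk lk.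
  rewrite normcM normcR gtr0_norm// ler_peMr ?(ltW r0)// normcM normcV.
  have lk0 : 0 < normc (1 - l * k%:C).
    rewrite lt_neqAle normc_ge0 andbT eq_sym; apply: contra lk => /eqP.
    by move/eq0_normc => ->.
  by rewrite ler_pdivlMr// mul1r disc_mobius.
have -> : (b - l * k%:C * a) *: (1 : bop H H) - (1 - l * k%:C) *: S =
    ((1 - l * k%:C) *: (1 : bop H H)) * (z *: (1 : bop H H) - S).
  by rewrite bop_scalerAl mul1r scalerBr scalerA /z mulrCA divff// mulr1.
by eexists; apply: bop_ring_inv_mul (scalar_inv _ lk) zB.
Qed.

(** Bernoulli's inequality, with [N] so large that [m.+1 * a ^- N < 1/2]. The number [a ^- N] is the
    error of a truncated geometric series for [1 / (a - z)]. *)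
Lemma near_one_pow_ex (a : R) (m : nat) : 1 < a ->
  exists N, (2^-1 <= (1 - a ^- N) ^+ m) && (a ^- N <= 1).
Proof.
move=> a1.
have a0 : 0 < a by rewrite (lt_trans ltr01).
have [N _ NP] : \forall n \near \oo, a^-1 ^+ n < (2^-1 / m.+1%:R).
  have q1n : `|a^-1| < 1 by rewrite gtr0_norm ?invr_gt0// invf_lt1.
  by have := cvgr_lt _ (cvg_expr q1n); apply; rewrite divr_gt0.
have e0 : 0 <= a^-1 ^+ N by rewrite exprn_ge0// invr_ge0 ltW.
have e1 : a^-1 ^+ N <= 1 by rewrite exprn_ile1// ?invr_ge0 ?(ltW a0)// invf_le1// ltW.
exists N; rewrite -exprVn e1 andbT (le_trans _ (bernoulli_le _ _))// ?e0//.
have /= h := NP N (leqnn _).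
have : m.+1%:R * a^-1 ^+ N < 2^-1 by rewrite mulrC -ltr_pdivlMr.
rewrite -natr1 mulrDl mul1r; lra.
Qed.

Lemma pencil_comm (a b : R[i]) :
  GRing.comm (a *: (1 : bop H H) - S) (b *: (1 : bop H H) - S).
Proof.
rewrite /GRing.comm !mulrBl !mulrBr !bop_scalerAl !bop_scalerAr !mul1r !mulr1.
by rewrite !scalerA mulrC !opprB addrACA [RHS]addrACA; congr (_ + _); rewrite addrC.
Qed.

Lemma rnorm_expr_ge (A : bop H H) (e : R) n u : 0 <= e ->
  (forall u, e * rnorm u <= rnorm (A u)) -> e ^+ n * rnorm u <= rnorm ((A ^+ n) u).
Proof.
move=> e0 Ae; elim: n => [|n ih]; first by rewrite !expr0 mul1r.
by rewrite !exprS -mulrA (le_trans (ler_wpM2l e0 ih)).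
Qed.

Lemma bop_ring_inv_exp (A B : bop H H) n :
  bop_ring_inv A B -> bop_ring_inv (A ^+ n) (B ^+ n).
Proof.
move=> AB; elim: n => [|n ih]; first by rewrite !expr0; split; rewrite mulr1.
by rewrite exprS exprSr; exact: bop_ring_inv_mul.
Qed.

Lemma bop_ring_inv_comm (A B C : bop H H) : bop_ring_inv B C ->
  GRing.comm A B -> GRing.comm A C.
Proof.
move=> [BC CB] AB; rewrite /GRing.comm -[LHS]mul1r -CB.
by rewrite -!mulrA [B * (A * C)]mulrA -AB -mulrA BC mulr1.
Qed.

(** With [G] close to [1 / (a - z)], take [p = ((b - z) * G)^n / (2 * k^n)]. Some power [n] of
    [k * (a - S) / (b - S)] has norm at most 1/4, which bounds [p(S)] below by [2 * (1 - e)^n]; on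
    the arc, [apollonius] bounds [p] by [(1 + e)^n / 2]. *)
Lemma peak_polynomial (x0 : R) :
  spectrum S `&` unit_circle R `<=` [set 1] -> x0 < 1 ->
  exists p : {poly R[i]}, (forall u, rnorm u <= rnorm (peval S p u)) /\
    forall z, normc z = 1 -> complex.Re z <= x0 -> normc p.[z] ^+ 2 <= 2^-1.
Proof.
move=> specS x01.
have [c [r [/andP[c0 c1] cr reg arc]]] := regular_off_disc S1 specS x01.
have r0 : 0 < r by rewrite (lt_trans _ cr)// subr_gt0.
(* [k] is chosen so that [a = (1 + c + r) / 2]. *)
pose k := r / ((1 - c + r) / 2).
have k1 : 1 < k by rewrite ltr_pdivlMr ?mul1r; lra.
have k0 : 0 < k by rewrite (lt_trans ltr01).
set a := c + r / k; set b := c + r * k.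
have a1 : 1 < a.
  by rewrite /a /k invf_div mulrCA divff ?gt_eqF// mulr1; lra.
clearbody k.
have ab : a < b by rewrite /a /b ltrD2l ltr_pM2l// (lt_trans _ k1)// invf_lt1.
have a0 : 0 < a by rewrite (lt_trans ltr01).
have b1 : 1 < b by rewrite (lt_trans a1).
have normRC (s : R) : 1 < s -> 1 < normc s%:C.
  by move=> s1; rewrite normcR gtr0_norm ?(lt_trans ltr01).
have [A' AA'] : regular S a%:C by apply: regular_gt1 => //; exact: normRC.
have [B' BB'] : regular S b%:C by apply: regular_gt1 => //; exact: normRC.
set A := a%:C *: (1 : bop H H) - S in AA'; set B := b%:C *: (1 : bop H H) - S in BB'.
pose X := k%:C *: (A * B').
have [l l1|m Xm] := @small_power _ _ X.
  have [C DC] := pencil_inv r0 k1 reg l1; rewrite -/a -/b -/A -/B in DC.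
  have -> : 1 - l *: X = (B - (l * k%:C) *: A) * B'.
    by rewrite mulrBl BB'.1 bop_scalerAl /X scalerA.
  by eexists; apply: bop_ring_inv_mul DC _; split; [exact: BB'.2|exact: BB'.1].
set n := (2 ^ m)%N in Xm.
have AB y : k ^+ n * rnorm ((A ^+ n) y) <= 4^-1 * rnorm ((B ^+ n) y).
  have -> : k ^+ n * rnorm ((A ^+ n) y) = rnorm ((X ^+ n) ((B ^+ n) y)).
    have cAB : GRing.comm A B' by apply: bop_ring_inv_comm BB' _; exact: pencil_comm.
    rewrite -bop_mulE bop_exprZn exprMn_comm// bop_scalerAl -mulrA.
    rewrite (bop_ring_inv_exp n BB').2 mulr1 bop_scaleE rnormZc normcX normcR.
    by rewrite gtr0_norm.
  by rewrite (le_trans (opnormP _ _))// ler_wpM2r ?rnorm_ge0.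
(* The exponent [n + n] gives [1/2 <= (1 - e)^n] and also, as [(1 + e) * (1 - e) <= 1],
   [(1 + e)^(2n) <= 2]. *)
have [N /andP[Nn N1]] := near_one_pow_ex (n + n) a1.
set e := a ^- N in Nn N1.
have e0 : 0 <= e by rewrite invr_ge0 exprn_ge0// ltW.
pose G : {poly R[i]} :=
  e%:C *: \sum_(i < N) a%:C%:P ^+ (N.-1 - i) * 'X ^+ i.
have GE : (a%:C%:P - 'X) * G = 1 - e%:C *: 'X^N.
  rewrite /G -scalerAr -subrXX scalerBr; congr (_ - _).
  rewrite -rmorphXn/= -mul_polyC -rmorphM/= -rmorphXn/= -rmorphM/=.
  by rewrite /e mulVf ?expf_neq0 ?gt_eqF.
clearbody G.
pose p : {poly R[i]} := (2 * k ^+ n)^-1%:C *: ((b%:C%:P - 'X) * G) ^+ n.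
have pE : p * (a%:C%:P - 'X) ^+ n =
    (2 * k ^+ n)^-1%:C *: ((1 - e%:C *: 'X^N) ^+ n * (b%:C%:P - 'X) ^+ n).
  rewrite /p -scalerAl; congr (_ *: _).
  by rewrite -exprMn -mulrA [G * _]mulrC GE exprMn mulrC.
have kn0 : 0 < (2 * k ^+ n)^-1 by rewrite invr_gt0 mulr_gt0// exprn_gt0.
have e1 : 0 <= 1 - e by rewrite subr_ge0.
have en : 2^-1 <= (1 - e) ^+ n.
  rewrite (le_trans Nn)// exprD ler_piMl ?exprn_ge0// exprn_ile1//.
  by rewrite lerBlDr lerDl.
exists p; split=> [x|z z1 zx0].
  (* Writing [x = (a - S)^n y] lets [pE] clear the denominator. *)
  pose y := (A' ^+ n) x.
  have xy : x = (A ^+ n) y by rewrite /y -bop_mulE (bop_ring_inv_exp n AA').1.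
  have -> : peval S p x = (2 * k ^+ n)^-1%:C *:
      (((1 - e%:C *: S ^+ N) ^+ n) ((B ^+ n) y)).
    have EA : A = peval S (a%:C%:P - 'X) by rewrite peval_real_sub.
    rewrite xy -bop_mulE EA -pevalXn -pevalM pE pevalZ pevalM.
    by rewrite !pevalXn peval_real_sub pevalB pevalZ pevalXn pevalX pevalC scale1r.
  rewrite rnormZc normcR gtr0_norm//.
  have h : (1 - e) ^+ n * rnorm ((B ^+ n) y) <=
      rnorm (((1 - e%:C *: S ^+ N) ^+ n) ((B ^+ n) y)).
    apply: rnorm_expr_ge => // u; rewrite bop_subE bop_1E mulrBl mul1r.
    rewrite (le_trans _ (ler_rnormB _ _))// lerD2l lerN2 bop_scaleE rnormZc normcR ger0_norm//.
    rewrite ler_wpM2l// (le_trans (opnormP _ _))// ler_piMl ?rnorm_ge0//.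
    exact: opnormX_contr.
  have := AB y; rewrite -xy => kx.
  rewrite mulrC ler_pdivlMr ?mulr_gt0 ?exprn_gt0//.
  rewrite (le_trans _ h)// (@le_trans _ _ (2^-1 * rnorm ((B ^+ n) y)))//.
    lra.
  by rewrite ler_wpM2r ?rnorm_ge0.
have az : 0 < normc (a%:C - z).
  rewrite (@lt_le_trans _ _ (a - 1)) ?subr_gt0//.
  have := @ler_rnormB _ R[i]^o a%:C z; rewrite !rnorm_normc z1 normcR.
  by rewrite gtr0_norm.
have abz := apollonius r0 k1 (arc z z1 zx0).
rewrite -/a -/b in abz.
have Gz : normc (a%:C - z) * normc G.[z] <= 1 + e.
  rewrite -normcM.
  have -> : (a%:C - z) * G.[z] = 1 - e%:C * z ^+ N.
    by have := congr1 (fun q => q.[z]) GE; rewrite !hornerE.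
  rewrite (le_trans (le_normcD _ _))// normcN normc1 lerD2l normcM normcR ger0_norm//.
  by rewrite normcX z1 expr1n mulr1.
have pz : normc p.[z] <= 2^-1 * (1 + e) ^+ n.
  rewrite /p hornerZ horner_exp !hornerE normcM normcX normcM normcR gtr0_norm//.
  rewrite invfM -mulrA ler_pM2l// mulrC ler_pdivrMr ?exprn_gt0//.
  rewrite -exprMn lerXn2r ?nnegrE ?mulr_ge0 ?normc_ge0 ?addr_ge0// ?(ltW k0)//.
  rewrite (le_trans (ler_wpM2r (normc_ge0 _) abz))//.
  have := Gz; have := normc_ge0 G.[z]; nra.
have en2 : (1 + e) ^+ (n + n) <= 2.
  have ee : (1 + e) * (1 - e) <= 1 by have := mulr_ge0 e0 e0; lra.
  have : ((1 + e) * (1 - e)) ^+ (n + n) <= 1.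
    by rewrite exprn_ile1// mulr_ge0// addr_ge0.
  rewrite exprMn; have : 0 <= (1 + e) ^+ (n + n) by rewrite exprn_ge0// addr_ge0.
  nra.
rewrite (@le_trans _ _ ((2^-1 * (1 + e) ^+ n) ^+ 2))//.
  by rewrite lerXn2r ?nnegrE ?normc_ge0// mulr_ge0// exprn_ge0// addr_ge0.
by rewrite exprMn -exprM muln2 -addnn; lra.
Qed.

End PeakPolynomial.

(** * The von Neumann inequality for pairs *)

Section Schur.
Variable R : realType.
Local Notation C := R[i].

(** Semi-inner products: the forms of [m^2 - T^* T] and [T^* T - 1] are needed besides inner
    products. *)
Definition psd_form (V : lmodType C) (f : V -> V -> C) : Prop :=
  [/\ forall a x y z, f (a *: x + y) z = a * f x z + f y z,
      forall x y, f x y = Num.conj (f y x) & forall x, 0 <= f x x].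

Section Forms.
Variables (V : lmodType C) (f : V -> V -> C).
Hypothesis ff : psd_form f.

Lemma psd_form0l z : f 0 z = 0.
Proof. by case: ff => fl _ _; have := fl (-1) 0 0 z; rewrite scaler0 addr0 mulN1r addNr. Qed.

Lemma psd_form_suml (I : Type) (s : seq I) (c : I -> C) (x : I -> V) z :
  f (\sum_(i <- s) c i *: x i) z = \sum_(i <- s) c i * f (x i) z.
Proof.
case: (ff) => fl _ _.
by elim: s => [|i s ih]; rewrite ?big_nil ?psd_form0l// !big_cons fl ih.
Qed.

Lemma psd_form_sumr (I : Type) (s : seq I) (c : I -> C) (x : I -> V) z :
  f z (\sum_(i <- s) c i *: x i) = \sum_(i <- s) Num.conj (c i) * f z (x i).
Proof.
case: (ff) => _ fC _.
rewrite fC psd_form_suml rmorph_sum; apply: eq_bigr => i _.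
by rewrite rmorphM/= -fC.
Qed.

End Forms.

Variables (E H : lmodType C) (g : E -> E -> C) (b : H -> H -> C).
Hypotheses (gf : psd_form g) (bf : psd_form b) (b0 : forall h, b h h = 0 -> h = 0).

(* Gram-Schmidt step: subtracting from each h_q its b-projection on h_0 removes
   h_0 from the sum, at the cost of a term b(h_0,h_0) g(v,v). *)
Lemma schur_product (s : seq (E * H)) :
  0 <= \sum_(p <- s) \sum_(q <- s) g p.1 q.1 * b p.2 q.2.
Proof.
have [n] := ubnP (size s); elim: n s => // n ih [|[e0 h0] s] sn.
  by rewrite big_nil.
case: (gf) => gl gC g0; case: (bf) => bl bC bge0.
(* If [b h0 h0 = 0] the quotient is 0 by convention, and [h0 = 0] by definiteness, so the projection
   formulas persist. *)
pose c (h : H) := b h h0 / b h0 h0.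
pose h' h := (- c h) *: h0 + h.
have cE h : b h h0 = c h * b h0 h0.
  have [/eqP b00|b00] := boolP (b h0 h0 == 0); last by rewrite /c divfK.
  by rewrite b00 mulr0 (b0 b00) bC (psd_form0l bf) rmorph0.
have b00C : Num.conj (b h0 h0) = b h0 h0 by rewrite -bC.
have bR x a y z : b x (a *: y + z) = Num.conj a * b x y + b x z.
  by rewrite bC bl rmorphD rmorphM/= -!bC.
have bE h k : b h k = b (h' h) (h' k) + c h * Num.conj (c k) * b h0 h0.
  rewrite /h' bl !bR (bC h0 k) (cE k) (cE h) !rmorphM rmorphN/= b00C.
  ring.
have h'0 : h' h0 = 0.
  rewrite /h' scaleNr /c; have [/b0 ->|b00] := eqVneq (b h0 h0) 0.
    by rewrite scaler0 oppr0 addr0.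
  by rewrite divff// scale1r addNr.
under eq_bigr => p _ do (under eq_bigr => q _ do rewrite bE mulrDr; rewrite big_split/=).
rewrite big_split/= addr_ge0//.
  rewrite big_cons/= h'0 big1 ?add0r; last by move=> q _; rewrite (psd_form0l bf) mulr0.
  under eq_bigr => p _ do rewrite big_cons/= h'0 bC (psd_form0l bf) rmorph0 mulr0 add0r.
  have := ih [seq (p.1, h' p.2) | p <- s]; rewrite size_map => /(_ sn).
  by rewrite big_map; under eq_bigr do rewrite big_map.
pose v := \sum_(p <- (e0, h0) :: s) c p.2 *: p.1.
rewrite [leRHS](_ : _ = b h0 h0 * g v v) ?mulr_ge0//.
rewrite (psd_form_suml gf) mulr_sumr; apply: eq_bigr => p _.
rewrite (psd_form_sumr gf) !mulr_sumr; apply: eq_bigr => q _.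
ring.
Qed.

End Schur.

(** * Discrete Fourier analysis over the roots of unity *)

Section Parseval.
Variables (R : realType) (n : nat) (w : R[i]).
Hypothesis wn : n.-primitive_root w.

Lemma prim_root_normc : normc w = 1.
Proof.
have n0 : (0 < n)%N := prim_order_gt0 wn.
apply: (@pexpIrn _ n n0); rewrite ?nnegrE ?normc_ge0// -normcX (prim_expr_order wn).
by rewrite expr1n normc1.
Qed.

Lemma prim_root_conj : Num.conj w = w^-1.
Proof.
by rewrite invC_norm normr_normc prim_root_normc expr1n invr1 mul1r.
Qed.

(** A geometric sum of ratio [w^j / w^l], an n-th root of unity that equals 1 only if [j = l]. *)
Lemma prim_root_sum j l : (j < n)%N -> (l < n)%N ->
  \sum_(k < n) w ^+ (k * j) * Num.conj (w ^+ (k * l)) = (j == l)%:R * n%:R.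
Proof.
move=> jn ln; have w0 : w != 0.
  by apply: contra_eq_neq prim_root_normc => ->; rewrite normc0 eq_sym oner_eq0.
pose z := w ^+ j / w ^+ l.
rewrite (eq_bigr (fun k : 'I_n => z ^+ k)); last first.
  move=> k _; rewrite rmorphXn/= prim_root_conj exprVn /z exprMn exprVn -!exprM.
  by rewrite mulnC [(l * k)%N]mulnC.
have [jl|jl] := eqVneq j l.
  rewrite mul1r /z jl divff ?expf_neq0// (eq_bigr (fun=> 1)) => [|k _].
    by rewrite sumr_const card_ord.
  by rewrite expr1n.
rewrite mul0r; apply/eqP.
have z1 : z - 1 != 0.
  rewrite subr_eq0 /z -(inj_eq (mulIf (expf_neq0 l w0))) divfK ?expf_neq0//.
  by rewrite mul1r (eq_prim_root_expr wn) !modn_small.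
rewrite -(inj_eq (mulfI z1)) mulr0 -subrX1 /z exprMn exprVn -!exprM.
by rewrite ![(_ * n)%N]mulnC !exprM (prim_expr_order wn) !expr1n divff ?oner_eq0// subrr.
Qed.

Lemma parseval (V : hilbertType R) (v : nat -> V) :
  \sum_(k < n) rnorm (\sum_(j < n) w ^+ (k * j) *: v j) ^+ 2 =
  n%:R * \sum_(j < n) rnorm (v j) ^+ 2.
Proof.
have nE (x : V) : (rnorm x ^+ 2)%:C = hdot V x x by rewrite hdot_norm normE rmorphXn.
apply: complexI; rewrite rmorphM rmorph_nat !rmorph_sum/=.
pose t (k : 'I_n) (j l : 'I_n) :=
  w ^+ (k * j) * Num.conj (w ^+ (k * l)) * hdot V (v j) (v l).
transitivity (\sum_(k < n) \sum_(j < n) \sum_(l < n) t k j l).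
  apply: eq_bigr => k _; rewrite nE hdot_suml; apply: eq_bigr => j _.
  rewrite hdotZl hdot_sumr mulr_sumr; apply: eq_bigr => l _.
  by rewrite hdot_sym hdotZl rmorphM/= -hdot_sym mulrA.
rewrite exchange_big mulr_sumr; apply: eq_bigr => j _ /=.
rewrite exchange_big (bigD1 j)//= [X in _ + X]big1 ?addr0 => [|l lj].
  by rewrite -mulr_suml prim_root_sum// eqxx mul1r nE.
rewrite -val_eqE eq_sym /= in lj.
by rewrite -mulr_suml prim_root_sum// (negbTE lj) !mul0r.
Qed.

End Parseval.

(** Moving the window by one trades its first term for the equal term one period later. *)
Lemma sum_ord_shift (V : zmodType) (n : nat) (g : nat -> V) i :
  (forall j, g (j + n)%N = g j) -> \sum_(j < n) g (i + j)%N = \sum_(j < n) g j.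
Proof.
move=> gn; elim: i => [|i ih]; first by apply: eq_bigr.
rewrite -[RHS]ih; case: n gn {ih} => [|n] gn; first by rewrite !big_ord0.
rewrite big_ord_recr big_ord_recl/= addSnnS gn addn0 addrC; congr (_ + _).
by apply: eq_bigr => j _; rewrite addSnnS.
Qed.

(** * Reduction to finite sums of elementary tensors *)

Section Density.
Variable R : realType.

Lemma rnorm_continuous (V : normedModType R[i]) : continuous (@rnorm R V : V -> R).
Proof.
move=> x; apply/cvgrPdist_lt => e e0.
near=> y.
have : rnorm (x - y) < e.
  rewrite -ltcR -normE; near: y; apply: cvgr_dist_lt; last by rewrite ltcR.
  exact: cvg_id.
apply: le_lt_trans; rewrite ler_norml ler_rnormB andbT lerNl opprB.
by rewrite rnorm_distC ler_rnormB.
Unshelve. all: by end_near. Qed.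

Lemma continuous_rnorm_sqr (V W : normedModType R[i]) (T : bop V W) :
  continuous (fun x => rnorm (T x) ^+ 2 : R).
Proof.
move=> x; apply: (@continuous_comp _ _ _ (fun x => rnorm (T x)) (fun y : R => y ^+ 2)).
  by apply: continuous_comp; [exact: bop_continuous|exact: rnorm_continuous].
exact: exprn_continuous.
Qed.

Variables (E H : hilbertType R) (EH : hilbertTensor E H).

Definition tensor_sum (s : seq (E * H)) : EH := \sum_(p <- s) tensor EH p.1 p.2.

(** The set where [f] is negative is open, so if it were nonempty it would contain a finite sum of
    elementary tensors. *)
Lemma tensor_dense_ge0 (f : EH -> R) : continuous f ->
  (forall s, 0 <= f (tensor_sum s)) -> forall u, 0 <= f u.
Proof.
move=> fc fs u; rewrite leNgt; apply/negP => fu.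
have [||v [/= fv [s _ sv]]] := @tensor_dense _ _ _ EH (f @^-1` [set x | x < 0]).
- by exists u.
- by apply: open_comp; [move=> x _; exact: fc|exact: open_lt].
by have := fs s; rewrite /tensor_sum sv leNgt fv.
Qed.

Lemma tensor_ext (V : normedModType R[i]) (T T' : bop EH V) :
  (forall e h, T (tensor EH e h) = T' (tensor EH e h)) -> T = T'.
Proof.
move=> TT'; apply: bopP => u; apply/eqP; rewrite -subr_eq0 -bop_subE.
have h := @tensor_dense_ge0 (fun u => - (rnorm ((T - T') u) ^+ 2)).
apply/eqP/rnorm0_eq0/eqP; rewrite -sqrf_eq0 eq_le sqr_ge0 andbT -oppr_ge0.
apply: h => [x|s]; first by apply: cvgN; exact: continuous_rnorm_sqr.
rewrite /tensor_sum linear_sum/= big1 ?rnorm0 ?expr0n ?oppr0// => p _.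
by rewrite TT' subrr.
Qed.

End Density.

(** * Positivity of tensor products of forms *)

Section TensorEnergy.
Variable R : realType.
Local Notation C := R[i].

Lemma hdot_psd (V : hilbertType R) : psd_form (hdot V).
Proof.
split=> [a x y z|x y|x]; [by rewrite hdotDl hdotZl|exact: hdot_sym|].
by rewrite hdot_norm exprn_ge0.
Qed.

Lemma hdot_rnorm (V : hilbertType R) (x : V) : hdot V x x = (rnorm x ^+ 2)%:C.
Proof. by rewrite hdot_norm normE rmorphXn. Qed.

Lemma defect_psd (V W : hilbertType R) (T : bop V W) (m : R) : opnorm T <= m ->
  psd_form (fun x y => (m ^+ 2)%:C * hdot V x y - hdot W (T x) (T y)).
Proof.
move=> Tm; split=> [a x y z|x y|x].
- by rewrite linearP/= !hdotDl !hdotZl; ring.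
- have mC : Num.conj (m ^+ 2)%:C = (m ^+ 2)%:C by rewrite conj_Creal// complex_real.
  move: mC; set c := (m ^+ 2)%:C => mC.
  by rewrite rmorphB rmorphM/= mC -!hdot_sym.
rewrite !hdot_rnorm -rmorphM -rmorphB/= ler0c subr_ge0 -exprMn.
rewrite lerXn2r ?nnegrE ?mulr_ge0 ?rnorm_ge0//; first exact: le_trans (opnorm_ge0 T) Tm.
by rewrite (le_trans (opnormP _ _))// ler_wpM2r ?rnorm_ge0.
Qed.

Lemma expansion_psd (V W : hilbertType R) (T : bop V W) :
  (forall x, rnorm x <= rnorm (T x)) ->
  psd_form (fun x y => hdot W (T x) (T y) - hdot V x y).
Proof.
move=> Tm; split=> [a x y z|x y|x].
- by rewrite linearP/= !hdotDl !hdotZl; ring.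
- by rewrite rmorphB/= -!hdot_sym.
rewrite !hdot_rnorm -rmorphB/= ler0c subr_ge0.
by rewrite lerXn2r ?nnegrE ?rnorm_ge0.
Qed.

Lemma rnorm_tensor_sum (E F H K : hilbertType R) (EH : hilbertTensor E H)
    (FK : hilbertTensor F K) (A : bop E F) (B : bop H K) s :
  (rnorm (tensor_bop EH FK A B (tensor_sum EH s)) ^+ 2)%:C =
  \sum_(p <- s) \sum_(q <- s) hdot F (A p.1) (A q.1) * hdot K (B p.2) (B q.2).
Proof.
rewrite -hdot_rnorm /tensor_sum linear_sum/= hdot_suml; apply: eq_bigr => p _.
rewrite hdot_sumr; apply: eq_bigr => q _.
by rewrite !tensor_bopE tensor_dot.
Qed.

(* In operator form: (|A|^2 - A^* A) (x) (1 - T^* T) >= 0. *)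
Lemma tensor_defect (E F H : hilbertType R) (EH : hilbertTensor E H)
    (FH : hilbertTensor F H) (A : bop E F) (T : bop H H) u : opnorm T < 1 ->
  rnorm (tensor_bop EH FH A 1 u) ^+ 2 - rnorm (tensor_bop EH FH A T u) ^+ 2 <=
  opnorm A ^+ 2 * (rnorm (tensor_bop EH EH 1 1 u) ^+ 2 - rnorm (tensor_bop EH EH 1 T u) ^+ 2).
Proof.
move=> T1; rewrite -subr_ge0.
pose f u : R := opnorm A ^+ 2 * (rnorm (tensor_bop EH EH 1 1 u) ^+ 2 -
    rnorm (tensor_bop EH EH 1 T u) ^+ 2) -
  (rnorm (tensor_bop EH FH A 1 u) ^+ 2 - rnorm (tensor_bop EH FH A T u) ^+ 2).
apply: (@tensor_dense_ge0 _ _ _ EH f) => [x|s].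
  apply: cvgB; first apply: cvgMr; apply: cvgB; exact: continuous_rnorm_sqr.
have fE (a x y z t : R) : (a * (x - y) - (z - t))%:C =
    a%:C * (x%:C - y%:C) - (z%:C - t%:C) :> C.
  by rewrite !(rmorphB, rmorphM).
rewrite -ler0c /f fE !rnorm_tensor_sum -!sumrB mulr_sumr -sumrB.
(* As [opnorm T < 1], the form of [1 - T^* T] is definite, which [schur_product] requires of its
   second form. *)
have bdef h : ((1 : R) ^+ 2)%:C * hdot H h h - hdot H (T h) (T h) = 0 -> h = 0.
  rewrite expr1n mul1r !hdot_rnorm => /eqP; rewrite subr_eq0 => /eqP/complexI hT.
  apply: rnorm0_eq0; apply/eqP; rewrite -sqrf_eq0; apply/eqP.
  have : rnorm (T h) ^+ 2 <= (opnorm T * rnorm h) ^+ 2.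
    by rewrite lerXn2r ?nnegrE ?mulr_ge0 ?opnorm_ge0 ?rnorm_ge0// opnormP.
  rewrite -hT exprMn => h1.
  have : opnorm T ^+ 2 < 1 by rewrite exprn_ilt1 ?opnorm_ge0.
  have := sqr_ge0 (rnorm h); nra.
have := schur_product (defect_psd (lexx (opnorm A))) (defect_psd (ltW T1)) bdef s.
congr (0 <= _); apply: eq_bigr => p _; rewrite -!sumrB mulr_sumr -sumrB.
apply: eq_bigr => q _; rewrite expr1n /=; ring.
Qed.

Lemma tensor_bop11 (E H : hilbertType R) (EH : hilbertTensor E H) :
  tensor_bop EH EH 1 1 = 1.
Proof. by apply: tensor_ext => e h; rewrite tensor_bopE. Qed.

(** In operator form: [1 (x) (T^* T - 1) >= 0]. *)
Lemma tensor_expansion (E H K : hilbertType R) (EH : hilbertTensor E H)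
    (EK : hilbertTensor E K) (T : bop H K) u :
  (forall h, rnorm h <= rnorm (T h)) -> rnorm u <= rnorm (tensor_bop EH EK 1 T u).
Proof.
move=> T1; have -> : rnorm u = rnorm (tensor_bop EH EH 1 1 u).
  by rewrite tensor_bop11.
rewrite -(@ler_pXn2r _ 2) ?nnegrE ?rnorm_ge0// -subr_ge0.
pose f u : R := rnorm (tensor_bop EH EK 1 T u) ^+ 2 - rnorm (tensor_bop EH EH 1 1 u) ^+ 2.
apply: (@tensor_dense_ge0 _ _ _ EH f) => [x|s].
  by apply: cvgB; exact: continuous_rnorm_sqr.
have fE (x y : R) : (x - y)%:C = x%:C - y%:C :> C by rewrite rmorphB.
rewrite -ler0c /f fE !rnorm_tensor_sum -sumrB.
(* The form of [T^* T - 1] may be degenerate, so the definite second form is the inner product of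
   [E], and the pairs are swapped. *)
have := schur_product (expansion_psd T1) (hdot_psd E) (@hdot_eq0 _ _) [seq (p.2, p.1) | p <- s].
congr (0 <= _); rewrite big_map; apply: eq_bigr => p _; rewrite big_map -sumrB.
by apply: eq_bigr => q _; rewrite mulrC mulrBr.
Qed.

End TensorEnergy.

(** * Operator polynomials of a contraction and their defects *)

Section TensorOperators.
Variable R : realType.

Lemma rnorm_tensor_le (E F H K : hilbertType R) (EH : hilbertTensor E H)
    (FK : hilbertTensor F K) (A : bop E F) (B : bop H K) u :
  rnorm (tensor_bop EH FK A B u) <= opnorm A * opnorm B * rnorm u.
Proof.
pose f u : R := opnorm A * opnorm B * rnorm u - rnorm (tensor_bop EH FK A B u).
rewrite -subr_ge0; apply: (@tensor_dense_ge0 _ _ _ EH f) => [x|s].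
  apply: cvgB; first by apply: cvgMr; exact: rnorm_continuous.
  by apply: continuous_comp; [exact: bop_continuous|exact: rnorm_continuous].
rewrite /f subr_ge0 -lecR -normE !rmorphM/= -normE /tensor_sum linear_sum/=.
under eq_bigr do rewrite tensor_bopE.
exact: tensor_norm_le.
Qed.

Lemma opnorm_tensor1_le (E H : hilbertType R) (EH : hilbertTensor E H)
    (T : bop H H) : opnorm (tensor_bop EH EH 1 T) <= opnorm T.
Proof.
apply: opnorm_le => [|u]; first exact: opnorm_ge0.
rewrite (le_trans (rnorm_tensor_le _ _ _ _))// ler_wpM2r ?rnorm_ge0//.
by rewrite ler_piMl ?opnorm_ge0 ?opnorm1.
Qed.

Lemma tensor_bopZr (E F H K : hilbertType R) (EH : hilbertTensor E H)
    (FK : hilbertTensor F K) (A : bop E F) (a : R[i]) (B : bop H K) :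
  tensor_bop EH FK A (a *: B) = a *: tensor_bop EH FK A B.
Proof.
apply: tensor_ext => e h; rewrite bop_scaleE !tensor_bopE bop_scaleE.
exact: linearZr.
Qed.

Variables (H E F : hilbertType R) (EH : hilbertTensor E H) (FH : hilbertTensor F H).
Variable T : bop H H.
Local Notation TE := (tensor_bop EH EH 1 T).
Local Notation TF := (tensor_bop FH FH 1 T).
Local Notation hat A := (tensor_bop EH FH A 1).

Lemma tensor_bop_expr n : TE ^+ n = tensor_bop EH EH 1 (T ^+ n).
Proof.
elim: n => [|n ih]; first by rewrite !expr0 tensor_bop11.
apply: tensor_ext => e h.
by rewrite exprS bop_mulE ih !tensor_bopE exprS.
Qed.

Lemma tensor_bop_split (A : bop E F) (B : bop H H) u :
  tensor_bop EH FH A B u = hat A (tensor_bop EH EH 1 B u).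
Proof.
rewrite -[RHS]/(bop_comp (hat A) (tensor_bop EH EH 1 B) u).
congr (bop_fun _ u); apply: tensor_ext => e h.
by rewrite /= !tensor_bopE.
Qed.

Lemma tensor_bop_shift_comm (A : bop E F) u : TF (hat A u) = hat A (TE u).
Proof.
rewrite -tensor_bop_split -[LHS]/(bop_comp TF (hat A) u).
congr (bop_fun _ u); apply: tensor_ext => e h.
by rewrite /= !tensor_bopE.
Qed.

Lemma op_poly_calcE (P : seq (bop E F)) u :
  op_poly_calc EH FH T P u = \sum_(j < size P) hat P`_j ((TE ^+ j) u).
Proof.
rewrite bop_sumE; apply: eq_bigr => j _.
by rewrite tensor_bop_split bop_expE -tensor_bop_expr.
Qed.

(** The coefficients act on the first tensor factor only and [T] on the second. *)
Lemma op_poly_calc_comm (P : seq (bop E F)) j u :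
  (TF ^+ j) (op_poly_calc EH FH T P u) = op_poly_calc EH FH T P ((TE ^+ j) u).
Proof.
elim: j u => [//|j ih] u; rewrite !exprSr !bop_mulE -ih; congr (_ _).
rewrite !op_poly_calcE linear_sum/=; apply: eq_bigr => i _.
by rewrite tensor_bop_shift_comm -!bop_mulE -exprS -exprSr.
Qed.

Lemma tensor_op_poly (P : seq (bop E F)) z u :
  hat (op_poly P z) u = \sum_(j < size P) z ^+ j *: hat P`_j u.
Proof.
have -> : hat (op_poly P z) = \sum_(j < size P) z ^+ j *: hat P`_j.
  apply: tensor_ext => e h; rewrite tensor_bopE /op_poly !bop_sumE.
  rewrite linear_sumlz; apply: eq_bigr => j _.
  by rewrite !bop_scaleE tensor_bopE linearZl_LR.
by rewrite bop_sumE.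
Qed.

(** The quadratic form of [1 - A^* A]; it telescopes along the orbit of [u]. *)
Definition defect (V : normedModType R[i]) (A : bop V V) u : R :=
  rnorm u ^+ 2 - rnorm (A u) ^+ 2.

Lemma defect_ge0 (V : normedModType R[i]) (A : bop V V) u :
  opnorm A <= 1 -> 0 <= defect A u.
Proof.
move=> A1; rewrite subr_ge0 lerXn2r ?nnegrE ?rnorm_ge0//.
by rewrite (le_trans (opnormP _ _))// ler_piMl ?rnorm_ge0.
Qed.

Lemma defect_sum (V : normedModType R[i]) (A : bop V V) u n :
  \sum_(j < n) defect A ((A ^+ j) u) = rnorm u ^+ 2 - rnorm ((A ^+ n) u) ^+ 2.
Proof.
elim: n => [|n ih]; first by rewrite big_ord0 expr0 subrr.
by rewrite big_ord_recr/= ih /defect [A ^+ n.+1]exprS bop_mulE addrA subrK.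
Qed.

(** Parseval's identity for [v] and for its image under [A]. *)
Lemma defect_parseval (V : hilbertType R) (A : bop V V) n (w : R[i]) (v : nat -> V) :
  n.-primitive_root w ->
  \sum_(k < n) defect A (\sum_(j < n) w ^+ (k * j) *: v j) =
  n%:R * \sum_(j < n) defect A (v j).
Proof.
move=> wn; rewrite /defect !sumrB (parseval wn) mulrBr; congr (_ - _).
rewrite -(parseval wn (fun j => A (v j))); apply: eq_bigr => k _; congr (rnorm _ ^+ 2).
by rewrite linear_sum/=; apply: eq_bigr => j _; rewrite linearZ.
Qed.

Hypothesis T1 : opnorm T < 1.

Lemma defect_tensor (A : bop E F) u :
  defect TF (hat A u) <= opnorm A ^+ 2 * defect TE u.
Proof.
have := tensor_defect FH A u T1.
rewrite /defect tensor_bop11 bop_1E tensor_bop_shift_comm.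
by rewrite [tensor_bop EH FH A T u]tensor_bop_split.
Qed.

(* Discrete Fourier analysis on Z/n of the sequence T^j x, extended with period
   n: it turns the cyclic convolution with P into multiplication by the values
   of P at the roots of unity, and for j < n - size P the convolution takes the
   value T^j P(T) x. *)
Lemma op_poly_calc_defect (P : seq (bop E F)) n (w : R[i]) (x : EH) :
  n.-primitive_root w -> (size P <= n)%N ->
  n%:R * (rnorm (op_poly_calc EH FH T P x) ^+ 2 -
     rnorm ((TF ^+ (n - size P)) (op_poly_calc EH FH T P x)) ^+ 2) <=
  \sum_(k < n) opnorm (op_poly P (w ^+ k)^-1) ^+ 2 *
     defect TE (\sum_(j < n) w ^+ (k * j) *: (TE ^+ j) x).
Proof.
move=> wn Pn; set y := op_poly_calc EH FH T P x.
have TF1 : opnorm TF <= 1 by rewrite (le_trans (opnorm_tensor1_le _ _))// ltW.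
pose a j := (TE ^+ (j %% n)) x.
pose d j := \sum_(i < size P) hat P`_i (a (i + j)%N).
(* There is no wrap-around here: [i + j < n]. *)
have dE j : (j < n - size P)%N -> d j = (TF ^+ j) y.
  move=> jn; rewrite op_poly_calc_comm op_poly_calcE; apply: eq_bigr => i _.
  rewrite /a modn_small ?exprD//.
  by rewrite (leq_trans (_ : _ < size P + j)%N) ?ltn_add2r// -leq_subRL// ltnW.
rewrite -defect_sum.
have le1 : \sum_(j < n - size P) defect TF ((TF ^+ j) y) <= \sum_(j < n) defect TF (d j).
  rewrite [leRHS](bigID (fun j : 'I_n => (j < n - size P)%N))/=.
  rewrite -[leLHS]addr0 lerD ?sumr_ge0// => [|j _]; last exact: defect_ge0.
  rewrite (big_ord_widen n (fun j => defect TF ((TF ^+ j) y)) (leq_subr _ _)).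
  by apply: ler_sum => j /dE ->.
rewrite (le_trans (ler_wpM2l _ le1))// -(defect_parseval _ _ wn).
apply: ler_sum => k _; rewrite (le_trans _ (defect_tensor _ _))//.
(* What remains is an equality: a shift by [i] multiplies the k-th Fourier sum by [(w^k)^-i], so [P]
   is evaluated at the inverse root. *)
rewrite tensor_op_poly le_eqVlt; apply/orP; left; apply/eqP; congr defect.
under eq_bigr => j _ do rewrite /d scaler_sumr.
rewrite exchange_big; apply: eq_bigr => i _ /=.
under eq_bigr => j _ do rewrite -linearZ.
rewrite -!linear_sum/= -linearZ/=; congr (_ _).
have w0 : w ^+ k != 0.
  rewrite expf_neq0//; apply: contra_eq_neq (prim_root_normc wn) => ->.
  by rewrite normc0 eq_sym oner_eq0.
pose g j := w ^+ (k * j) *: a j.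
have gn j : g (j + n)%N = g j.
  rewrite /g /a modnDr mulnDr exprD [X in _ * X](_ : _ = 1) ?mulr1//.
  by rewrite mulnC exprM (prim_expr_order wn) expr1n.
rewrite [in RHS](eq_bigr (fun j : 'I_n => g j)); last first.
  by move=> j _; rewrite /g /a modn_small.
rewrite -(sum_ord_shift i gn) scaler_sumr; apply: eq_bigr => j _.
by rewrite /g scalerA mulnDr exprD mulrA exprVn -exprM mulVf ?mul1r// exprM expf_neq0.
Qed.

End TensorOperators.

Section VonNeumann.
Variables (R : realType) (H E F G : hilbertType R).
Variables (EH : hilbertTensor E H) (FH : hilbertTensor F H) (GH : hilbertTensor G H).
Variables (P : seq (bop E F)) (Q : seq (bop E G)) (C : R).
Hypothesis PQC : forall z, normc z = 1 ->
  opnorm (op_poly P z) ^+ 2 + opnorm (op_poly Q z) ^+ 2 <= C.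

(** The weights [D k] are the same for [P] and [Q], so the pointwise hypothesis can be summed
    against them; their total is at most [n * |x|^2]. The leftover high powers of [T] tend to 0. *)
Lemma von_neumann_strict (T : bop H H) (x : EH) : opnorm T < 1 ->
  rnorm (op_poly_calc EH FH T P x) ^+ 2 + rnorm (op_poly_calc EH GH T Q x) ^+ 2 <=
  C * rnorm x ^+ 2.
Proof.
move=> T1; have T0 := opnorm_ge0 T.
set y := op_poly_calc EH FH T P x; set z := op_poly_calc EH GH T Q x.
apply/ler_addgt0Pr => e e0.
pose K := rnorm y ^+ 2 + rnorm z ^+ 2 + 1.
have K0 : 0 < K by rewrite ltr_wpDl// addr_ge0// sqr_ge0.
have [m _ mP] : \forall n \near \oo, opnorm T ^+ n < e / K.
  have q1n : `|opnorm T| < 1 by rewrite ger0_norm.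
  by have := cvgr_lt _ (cvg_expr q1n); apply; rewrite divr_gt0.
(* Both leftover powers, [n - size P] and [n - size Q], are at least [m], and [n] is positive. *)
pose n := (m + size P + size Q).+1.
have [w wn] := @prim_root_exists R n isT.
have tail (V : hilbertType R) (VH : hilbertTensor V H) (v : VH) k : (m <= k)%N ->
    rnorm ((tensor_bop VH VH 1 T ^+ k) v) ^+ 2 <= e / K * rnorm v ^+ 2.
  move=> mk; have := mP k mk => /= ek.
  have Tk1 : opnorm T ^+ k <= 1 by rewrite exprn_ile1// ltW.
  have Tk0 : 0 <= opnorm T ^+ k by rewrite exprn_ge0.
  have h : rnorm ((tensor_bop VH VH 1 T ^+ k) v) <= opnorm T ^+ k * rnorm v.
    rewrite (le_trans (opnormP _ _))// ler_wpM2r ?rnorm_ge0//.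
    rewrite (le_trans (opnormX _ _))// lerXn2r ?nnegrE ?opnorm_ge0//.
    exact: opnorm_tensor1_le.
  have h2 : rnorm ((tensor_bop VH VH 1 T ^+ k) v) ^+ 2 <= (opnorm T ^+ k * rnorm v) ^+ 2.
    by rewrite lerXn2r ?nnegrE ?mulr_ge0 ?rnorm_ge0.
  rewrite (le_trans h2)// exprMn ler_wpM2r ?sqr_ge0// expr2.
  by rewrite (le_trans _ (ltW ek))// ler_piMl.
pose D k := defect (tensor_bop EH EH 1 T)
  (\sum_(j < n) w ^+ (k * j) *: (tensor_bop EH EH 1 T ^+ j) x).
have D0 k : 0 <= D k.
  by apply: defect_ge0; rewrite (le_trans (opnorm_tensor1_le _ _))// ltW.
have Psz : (size P <= n)%N by rewrite /n; lia.
have Qsz : (size Q <= n)%N by rewrite /n; lia.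
have hP := op_poly_calc_defect FH T1 x wn Psz.
have hQ := op_poly_calc_defect GH T1 x wn Qsz.
rewrite -/y in hP; rewrite -/z in hQ.
have tP := @tail _ FH y (n - size P)%N _.
have tQ := @tail _ GH z (n - size Q)%N _.
have {}tP := tP (ltac:(by rewrite /n; lia)).
have {}tQ := tQ (ltac:(by rewrite /n; lia)).
have C0 : 0 <= C.
  by have := PQC (@normc1 R); apply: le_trans; rewrite addr_ge0// sqr_ge0.
have DC : \sum_(k < n) opnorm (op_poly P (w ^+ k)^-1) ^+ 2 * D k +
    \sum_(k < n) opnorm (op_poly Q (w ^+ k)^-1) ^+ 2 * D k <=
    n%:R * (C * rnorm x ^+ 2).
  rewrite -big_split/= (@le_trans _ _ (\sum_(k < n) C * D k))//.
    apply: ler_sum => k _; rewrite -mulrDl ler_wpM2r// PQC// normcV normcX.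
    by rewrite (prim_root_normc wn) expr1n invr1.
  rewrite -mulr_sumr /D (defect_parseval _ (fun j => (tensor_bop EH EH 1 T ^+ j) x) wn).
  rewrite defect_sum mulrCA ler_wpM2l ?ler0n// ler_wpM2l//.
  by rewrite lerBlDr lerDl sqr_ge0.
have n0 : 0 < n%:R :> R by rewrite ltr0n.
have key : n%:R * (rnorm y ^+ 2 + rnorm z ^+ 2 - e) <= n%:R * (C * rnorm x ^+ 2).
  apply: le_trans DC; apply: le_trans (lerD hP hQ).
  rewrite -mulrDr ler_wpM2l ?(ltW n0)//.
  have : e / K * rnorm y ^+ 2 + e / K * rnorm z ^+ 2 <= e.
    rewrite -mulrDr -mulrA ler_piMr ?(ltW e0)// mulrC ler_pdivrMr// mul1r.
    by rewrite lerDl.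
  lra.
by move: key; rewrite ler_pM2l// lerBlDr.
Qed.

Lemma op_poly_calcZ (V : hilbertType R) (VH : hilbertTensor V H) (S : bop H H)
    (U : seq (bop E V)) (r : R) x :
  op_poly_calc EH VH (r%:C *: S) U x =
  \sum_(j < size U) (r ^+ j)%:C *: tensor_bop EH VH U`_j (S ^+ j) x.
Proof.
rewrite bop_sumE; apply: eq_bigr => j _.
by rewrite bop_expE bop_exprZn tensor_bopZr bop_scaleE rmorphXn.
Qed.

(** Coefficientwise, [1 - (1 - r)^j <= j * r] by Bernoulli's inequality. *)
Lemma op_poly_calc_lip (V : hilbertType R) (VH : hilbertTensor V H) (S : bop H H)
    (U : seq (bop E V)) x : exists2 L : R, 0 <= L & forall r, 0 <= r <= 1 ->
  `|rnorm (op_poly_calc EH VH S U x) -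
    rnorm (op_poly_calc EH VH ((1 - r)%:C *: S) U x)| <= r * L.
Proof.
pose v j := tensor_bop EH VH U`_j (S ^+ j) x.
exists (\sum_(j < size U) j%:R * rnorm (v j)) => [|r r01].
  by apply: sumr_ge0 => j _; rewrite mulr_ge0 ?rnorm_ge0.
have d : rnorm (op_poly_calc EH VH S U x -
    op_poly_calc EH VH ((1 - r)%:C *: S) U x) <=
    r * (\sum_(j < size U) j%:R * rnorm (v j)).
  rewrite -{1}(scale1r S) (_ : 1 = 1%:C)// !op_poly_calcZ -sumrB.
  rewrite (le_trans (ler_rnorm_sum _ _ _))// mulr_sumr; apply: ler_sum => j _.
  rewrite expr1n -scalerBl -rmorphB/= rnormZc normcR mulrA ler_wpM2r ?rnorm_ge0//.
  have := bernoulli_le j r01; move: r01 => /andP[r0 r1] h.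
  rewrite ger0_norm; first by lra.
  by rewrite subr_ge0 exprn_ile1// ?subr_ge0// lerBlDr lerDl.
rewrite ler_norml (le_trans (ler_rnormB _ _) d) andbT lerNl opprB.
by rewrite (le_trans (ler_rnormB _ _))// rnorm_distC.
Qed.

(** The strict case applies to [(1 - r) S], with [r] small. *)
Lemma von_neumann (S : bop H H) (x : EH) : opnorm S <= 1 ->
  rnorm (op_poly_calc EH FH S P x) ^+ 2 + rnorm (op_poly_calc EH GH S Q x) ^+ 2 <=
  C * rnorm x ^+ 2.
Proof.
move=> S1.
have [L1 L10 lip1] := op_poly_calc_lip FH S P x.
have [L2 L20 lip2] := op_poly_calc_lip GH S Q x.
set a := rnorm (op_poly_calc EH FH S P x) in lip1 *.
set b := rnorm (op_poly_calc EH GH S Q x) in lip2 *.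
have a0 : 0 <= a := rnorm_ge0 _; have b0 : 0 <= b := rnorm_ge0 _.
apply/ler_addgt0Pr => e e0.
(* The first two terms are the errors of [sq] below, divided by [r]; the 1 keeps [M] positive. *)
pose M := 2 * (a + L1) * L1 + 2 * (b + L2) * L2 + 1.
have M0 : 0 < M by rewrite ltr_wpDl// addr_ge0// !mulr_ge0// addr_ge0.
pose r := Num.min (e / M) 2^-1.
have r0 : 0 < r by rewrite lt_min divr_gt0//= invr_gt0.
have r2 : r <= 2^-1 by rewrite ge_min lexx orbT.
have r01 : 0 <= r <= 1 by rewrite ltW//=; lra.
have Tr : opnorm ((1 - r)%:C *: S) < 1.
  rewrite opnormZ normcR ger0_norm; last by lra.
  have := opnorm_ge0 S; nra.
have := von_neumann_strict x Tr; have := lip1 r r01; have := lip2 r r01.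
set a' := rnorm (op_poly_calc _ FH ((1 - r)%:C *: S) P x).
set b' := rnorm (op_poly_calc _ GH ((1 - r)%:C *: S) Q x).
have a'0 : 0 <= a' := rnorm_ge0 _; have b'0 : 0 <= b' := rnorm_ge0 _.
rewrite !ler_norml => /andP[hb1 hb2] /andP[ha1 ha2] h.
have rM : r * M <= e by rewrite -ler_pdivlMr// ge_min lexx.
have sq (u v L : R) : 0 <= u -> 0 <= v -> 0 <= L -> u - v <= r * L ->
    u ^+ 2 <= v ^+ 2 + r * (2 * (u + L) * L).
  move=> u0 v0 L0 uv; have [uv'|vu] := leP u v.
    rewrite (@le_trans _ _ (v ^+ 2)) ?lerXn2r ?nnegrE//.
    by rewrite lerDl !mulr_ge0 ?(ltW r0)// addr_ge0.
  have : (u - v) * (u + v) <= r * L * (2 * u).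
    by rewrite ler_pM ?subr_ge0 ?(ltW vu) ?addr_ge0//; lra.
  have : 0 <= r * (L * L) by rewrite !mulr_ge0// ltW.
  lra.
have {}ha := sq a a' L1 a0 a'0 L10 ha2.
have {}hb := sq b b' L2 b0 b'0 L20 hb2.
apply: (le_trans (lerD ha hb)); rewrite addrACA -mulrDr lerD//.
apply: le_trans rM; rewrite ler_wpM2l ?(ltW r0)//.
by rewrite /M lerDl.
Qed.

End VonNeumann.

(** * The disc algebra *)

Section DiscAlgebra.
Variables (R : realType) (E F : hilbertType R).
Implicit Types W : R[i]^o -> bop E F.

Lemma disc_algebra_near W z (e : R) : disc_algebra W -> normc z <= 1 -> 0 < e ->
  exists2 d : R, 0 < d &
    forall w, normc w <= 1 -> normc (w - z) < d -> opnorm (W w - W z) < e.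
Proof.
move=> [/subspace_continuousP Wc _] z1 e0.
have zD : closed_unit_disc z by rewrite /closed_unit_disc/= normr_normc lecR.
have /cvgrPdist_lt/(_ e%:C) := Wc z zD; rewrite ltcR => /(_ e0).
rewrite near_withinE => /nbhs_ballP[d /= d0 dW].
have dE : d = (complex.Re d)%:C by rewrite RRe_real// gtr0_real.
exists (complex.Re d) => [|w w1 wz]; first by rewrite -ltcR -dE.
rewrite opnorm_distC -ltcR -bop_normE; apply: dW.
  by rewrite -ball_normE/= dE normr_normc ltcR -normcN opprB.
by rewrite /closed_unit_disc/= normr_normc lecR.
Qed.

Lemma disc_algebra_bounded W : disc_algebra W ->
  exists M : R, forall z, normc z <= 1 -> opnorm (W z) <= M.
Proof.
(* The bound is written [e^-1] so that it weakens as [e] decreases; the second disjunct keeps [Pr]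
   monotone where the inverse is not. *)
move=> WA; pose Pr (e : R) z := opnorm (W z) <= e^-1 \/ e <= 0.
have [e d z de [We|e0]|z z1|e e0 eP] := @closed_disc_uniform R Pr.
- have [d0|d0] := leP d 0; first by right.
  by left; rewrite (le_trans We)// lef_pV2 ?posrE// (lt_le_trans d0).
- by right; rewrite (le_trans de).
- have [d d0 dW] := disc_algebra_near WA z1 ltr01.
  pose N := (opnorm (W z) + 1)^-1.
  have N0 : 0 < N by rewrite invr_gt0 ltr_wpDl ?opnorm_ge0.
  exists (Num.min d N) => [|w w1 wz]; first by rewrite lt_min d0.
  left; have := dW w w1 (lt_le_trans wz _); rewrite ge_min lexx => /(_ isT) h.
  rewrite (@le_trans _ _ N^-1)//; last by rewrite lef_pV2 ?posrE ?lt_min ?d0// ge_min lexx orbT.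
  rewrite /N invrK -{1}(subrK (W z) (W w)) (le_trans (opnormD _ _))// addrC lerD2l.
  exact: ltW.
- exists e^-1 => z /eP[//|]; by rewrite leNgt e0.
Qed.

(** The bound [M] ensures that [disc_norm W] is a true supremum and not a default value. *)
Lemma disc_norm_ge W z (M : R) : (forall z, normc z = 1 -> opnorm (W z) <= M) ->
  normc z = 1 -> opnorm (W z) <= disc_norm W.
Proof.
move=> WM z1; apply: ub_le_sup; last by exists z => //; rewrite /unit_circle/= normr_normc z1.
by exists M => _ [w w1 <-]; apply: WM; apply: complexI; rewrite -normr_normc w1.
Qed.

Lemma op_poly_bounded (P : seq (bop E F)) z : normc z = 1 ->
  opnorm (op_poly P z) <= \sum_(j < size P) opnorm P`_j.
Proof.
move=> z1; rewrite /op_poly (le_trans (@ler_rnorm_sum _ (bop E F) _ _ _ _))//.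
apply: ler_sum => j _; rewrite (@rnormZc _ (bop E F)) normcX z1 expr1n mul1r.
exact: lexx.
Qed.

End DiscAlgebra.

(** * Scalar polynomials as the second member of the pair *)

Section ScalarPolynomials.
Variables (R : realType) (E H : hilbertType R) (EH : hilbertTensor E H).

Definition scalar_seq (p : {poly R[i]}) : seq (bop E E) :=
  [seq c *: (1 : bop E E) | c <- p].

Lemma op_poly_scalar p z : op_poly (scalar_seq p) z = p.[z] *: (1 : bop E E).
Proof.
rewrite /op_poly size_map horner_coef scaler_suml; apply: eq_bigr => j _.
by rewrite (nth_map 0)// scalerA mulrC.
Qed.

Lemma op_poly_calc_scalar (S : bop H H) p :
  op_poly_calc EH EH S (scalar_seq p) = tensor_bop EH EH 1 (peval S p).
Proof.
apply: tensor_ext => e h; rewrite tensor_bopE /op_poly_calc /peval !bop_sumE size_map.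
rewrite linear_sumr/=; apply: eq_bigr => j _.
rewrite tensor_bopE (nth_map 0)// bop_expE !bop_scaleE !bop_1E.
by rewrite linearZl_LR linearZr_LR.
Qed.

Lemma horner_bounded (p : {poly R[i]}) z : normc z = 1 ->
  normc p.[z] <= \sum_(j < size p) normc p`_j.
Proof.
move=> z1; rewrite horner_coef (le_trans (@ler_rnorm_sum _ R[i]^o _ _ _ _))//.
apply: ler_sum => j _; rewrite rnorm_normc normcM normcX z1 expr1n mulr1.
exact: lexx.
Qed.

End ScalarPolynomials.

(** * The strict inequality, from the pair inequality and the peak polynomial *)

Theorem theorem10p3 (R : realType) (H E F : hilbertType R)
    (EH : hilbertTensor E H) (FH : hilbertTensor F H)
    (S : bop H H) (W : R[i]^o -> bop E F) (WS : bop EH FH) :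
  opnorm S <= 1 ->
  spectrum S `&` unit_circle R `<=` [set 1] ->
  disc_algebra W ->
  disc_norm W > opnorm (W 1) ->
  is_disc_calc S W WS ->
  opnorm WS < disc_norm W.
Proof.
move=> S1 specS WA; set m := disc_norm W => mW [P [PW PS]].
have [M0 WM0] := disc_algebra_bounded WA.
have Wm z : normc z = 1 -> opnorm (W z) <= m.
  by apply: disc_norm_ge => w w1; apply: WM0; rewrite w1.
have w10 := opnorm_ge0 (W 1).
have m0 : 0 < m by rewrite (le_lt_trans w10).
pose m' := (m + opnorm (W 1)) / 2.
have m'0 : 0 <= m' by rewrite /m'; lra.
have m'm : m' < m by rewrite /m'; lra.
have [||d d0 dW] := @disc_algebra_near _ _ _ W 1 (m' - opnorm (W 1)) WA.
- by rewrite normc1.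
- by rewrite /m'; lra.
(* On the unit circle [|z - 1|^2 = 2 - 2 * Re z], so [x0 < Re z] means [|z - 1| < d]. *)
pose x0 := 1 - d ^+ 2 / 2.
have x01 : x0 < 1 by rewrite /x0 ltrBlDr ltrDl divr_gt0// exprn_gt0.
have Wx0 z : normc z = 1 -> x0 < complex.Re z -> opnorm (W z) <= m'.
  move=> z1 zx0; have : opnorm (W z - W 1) < m' - opnorm (W 1).
    apply: dW; rewrite ?z1//.
    rewrite -(@ltr_pXn2r _ 2)// ?nnegrE ?normc_ge0 ?(ltW d0)//.
    have : normc z ^+ 2 = 1 by rewrite z1 expr1n.
    rewrite !sqr_normc_ReIm raddfB; move: zx0; case: (z) => s t /=.
    rewrite /x0; nra.
  have := opnormD (W z - W 1) (W 1); rewrite subrK; lra.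
have [p [pS px0]] := peak_polynomial S1 specS x01.
pose M := (\sum_(j < size p) normc p`_j) ^+ 2.
have pM z : normc z = 1 -> normc p.[z] ^+ 2 <= M.
  move=> z1; rewrite lerXn2r ?nnegrE ?normc_ge0 ?horner_bounded//.
  by rewrite sumr_ge0// => j _; rewrite normc_ge0.
have M_ge0 : 0 <= M by rewrite sqr_ge0.
(* The weight [s] of [p] makes the peak of [p] near 1 fill the gap between
   [m' ^ 2] and [m ^ 2]. *)
pose s := (m ^+ 2 - m' ^+ 2) / (M + 1).
have M1 : 0 < M + 1 by rewrite ltr_wpDl.
have s0 : 0 < s by rewrite divr_gt0// subr_gt0 ltrXn2r ?nnegrE// (ltW m0).
have sM : m' ^+ 2 + s * M <= m ^+ 2.
  have : s * (M + 1) = m ^+ 2 - m' ^+ 2 by rewrite divfK// gt_eqF.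
  by move=> h; lra.
pose t := Num.sqrt s.
have t2 : t ^+ 2 = s by rewrite sqr_sqrtr// ltW.
pose Q := scalar_seq E (t%:C *: p).
have Qz z : opnorm (op_poly Q z) ^+ 2 <= s * normc p.[z] ^+ 2.
  rewrite op_poly_scalar hornerZ opnormZ normcM normcR -t2 ger0_norm ?sqrtr_ge0//.
  rewrite -exprMn lerXn2r ?nnegrE ?mulr_ge0 ?normc_ge0 ?sqrtr_ge0 ?opnorm_ge0//.
  by rewrite ler_piMr ?opnorm1// mulr_ge0 ?normc_ge0 ?sqrtr_ge0.
have QS x : s * rnorm x ^+ 2 <= rnorm (op_poly_calc EH EH S Q x) ^+ 2.
  rewrite op_poly_calc_scalar pevalZ tensor_bopZr bop_scaleE rnormZc normcR.
  rewrite exprMn ger0_norm ?sqrtr_ge0// t2 ler_wpM2l ?(ltW s0)//.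
  by rewrite lerXn2r ?nnegrE ?rnorm_ge0// tensor_expansion.
have sm : s <= m ^+ 2.
  have := mulr_ge0 (ltW s0) M_ge0; have : s * (M + 1) = m ^+ 2 - m' ^+ 2.
    by rewrite divfK// gt_eqF.
  have := sqr_ge0 m'; lra.
(* The pair inequality holds with a constant near [m^2 + s / 2]; as [Q(S)] contributes at least
   [s * |x|^2], the bound left for [P n] is near [m^2 - s / 2]. *)
have PSn n : opnorm (op_poly_calc EH FH S (P n)) ^+ 2 <=
    m ^+ 2 - s / 2 + 2 * m * disc_norm (fun z => op_poly (P n) z - W z) +
    disc_norm (fun z => op_poly (P n) z - W z) ^+ 2.
  pose V (z : R[i]^o) := op_poly (P n) z - W z; rewrite -/V; set e := disc_norm V.
  have Ve z : normc z = 1 -> opnorm (V z) <= e.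
    apply: (@disc_norm_ge _ _ _ V _ (\sum_(j < size (P n)) opnorm (P n)`_j + M0)) => w w1.
    by rewrite (le_trans (opnormB _ _))// lerD ?op_poly_bounded// WM0// w1.
  have e0 : 0 <= e := le_trans (opnorm_ge0 _) (Ve 1 (@normc1 R)).
  have Pe z : normc z = 1 -> opnorm (op_poly (P n) z) <= opnorm (W z) + e.
    move=> z1; have := opnormD (V z) (W z); have := Ve z z1.
    by rewrite /V subrK; lra.
  have me0 : 0 <= 2 * m * e by rewrite !mulr_ge0// ltW.
  have PQ z : normc z = 1 -> opnorm (op_poly (P n) z) ^+ 2 + opnorm (op_poly Q z) ^+ 2 <=
      m ^+ 2 + s / 2 + 2 * m * e + e ^+ 2.
    move=> z1; have hP := Pe z z1; have hQ := Qz z.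
    have P0 := opnorm_ge0 (op_poly (P n) z).
    (* Away from 1 the polynomial [p] is small; near 1 it is only bounded by [M], but there [W] is
       at most [m']. *)
    have [zx|zx] := leP (complex.Re z) x0.
      have := px0 z z1 zx; rewrite -(ler_pM2l s0) => hp.
      have : opnorm (op_poly (P n) z) ^+ 2 <= (m + e) ^+ 2.
        rewrite lerXn2r ?nnegrE ?addr_ge0 ?(ltW m0)// (le_trans hP)// lerD2r.
        exact: Wm.
      by rewrite sqrrD; lra.
    have := pM z z1; rewrite -(ler_pM2l s0) => hp.
    have : opnorm (op_poly (P n) z) ^+ 2 <= (m' + e) ^+ 2.
      rewrite lerXn2r ?nnegrE ?addr_ge0// (le_trans hP)// lerD2r.
      exact: Wx0.
    have : m' * e <= m * e by rewrite ler_wpM2r// ltW.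
    by rewrite sqrrD; lra.
  have C0 : 0 <= m ^+ 2 - s / 2 + 2 * m * e + e ^+ 2.
    by have := sqr_ge0 e; lra.
  rewrite -(sqr_sqrtr C0) lerXn2r ?nnegrE ?opnorm_ge0 ?sqrtr_ge0//.
  apply: opnorm_le => [|x]; first exact: sqrtr_ge0.
  rewrite -(@ler_pXn2r _ 2)// ?nnegrE ?mulr_ge0 ?rnorm_ge0 ?sqrtr_ge0//.
  rewrite exprMn sqr_sqrtr//.
  have := @von_neumann _ _ _ _ _ EH FH EH _ _ _ PQ S x S1; have := QS x; lra.
(* Half of the gain [s / 2] absorbs the error of approximating [W] by [P n], so [k] does not depend
   on [n]. *)
pose k := Num.sqrt (m ^+ 2 - s / 4).
have k2 : k ^+ 2 = m ^+ 2 - s / 4 by rewrite sqr_sqrtr//; lra.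
have k0 : 0 <= k by rewrite sqrtr_ge0.
have km : k < m by rewrite -(@ltr_pXn2r _ 2)// ?nnegrE ?(ltW m0)// k2; lra.
have near1 : \forall n \near \oo, 2 * m * disc_norm (fun z => op_poly (P n) z - W z) +
    disc_norm (fun z => op_poly (P n) z - W z) ^+ 2 < s / 4.
  have : (2 * m * disc_norm (fun z => op_poly (P n) z - W z) +
    disc_norm (fun z => op_poly (P n) z - W z) ^+ 2) @[n --> \oo] --> (2 * m * 0 + 0 ^+ 2 : R).
    apply: cvgD; first by apply: cvgMr.
    exact: (@cvg_comp _ _ _ _ (fun x : R => x ^+ 2) _ _ _ PW (@exprn_continuous _ _ _)).
  rewrite mulr0 add0r expr0n /= => h; apply: (cvgr_lt _ h).
  by rewrite divr_gt0.
have near2 : \forall n \near \oo, rnorm (op_poly_calc EH FH S (P n) - WS) < m - k.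
  by move/cvg_rnormP : PS => PS; apply: (cvgr_lt _ PS); rewrite subr_gt0.
have [n [n1 n2]] := filter_ex (filterI near1 near2).
have Pk : opnorm (op_poly_calc EH FH S (P n)) <= k.
  rewrite -(@ler_pXn2r _ 2)// ?nnegrE ?opnorm_ge0// k2.
  by have := PSn n; lra.
have := opnormD (op_poly_calc EH FH S (P n)) (WS - op_poly_calc EH FH S (P n)).
rewrite addrC subrK => h; rewrite (le_lt_trans h)//.
rewrite [opnorm (WS - _)]opnorm_distC; rewrite rnorm_opnorm in n2; lra.
Qed.
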